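(* Let $d,K\ge 1$ be integers, $\mathbb X\subseteq\mathbb R^d$, $x_0\in\mathbb R^d$, $\delta\ge 0$, $\varepsilon\ge0$, and let $c:\mathbb R^d\times\mathbb R^d\to[0,\infty)$ be continuous. For each $k\in\{1,\dots,K\}$ let $\hat\theta_k\in\mathbb R^d$, let $\hat\Sigma_k$ be a symmetric positive definite $d\times d$ matrix, and let $\rho_k\ge 0$. Let $\hat p\in\mathbb R_+^K$ with $\sum_{k=1}^K\hat p_k=1$. Consider the problem $$\min_{x\in\mathbb X}\ \sup_{\mathbb Q\in\mathcal U(\hat{\mathbb P})}\mathbb Q(\tilde\theta^\top x\le 0)\quad\text{s.t.}\quad c(x,x_0)\le\delta,\quad \sup_{\mathbb Q_k\in\mathcal B_k(\hat{\mathbb P}_k)}\mathbb Q_k(\tilde\theta^\top x\le 0)<1\ \ \forall k\in\{1,\dots,K\}.$$ The feasible set of this problem coincides with $$\mathcal X=\left\{x\in\mathbb X:\ c(x,x_0)\le\delta,\ \ -\hat\theta_k^\top x+\rho_k\|x\|_2<0\ \ \forall k\in\{1,\dots,K\}\right\}.$$ Further, for every $x\in\mathcal X$, the objective value of this problem equals the optimal value of a convex optimization problem: $$\sup_{\mathbb Q\in\mathcal U(\hat{\mathbb P})}\mathbb Q(\tilde\theta^\top x\le 0)=\min_{\lambda\in\mathbb R_+,\ \eta\in\mathbb R}\ \eta+\varepsilon\lambda+\lambda\sum_{k=1}^K\hat p_k\,\phi^*\!\left(\frac{f_k(x)-\eta}{\lambda}\right),$$ where $f_k(x)=\sup_{\mathbb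 Q_k\in\mathcal B_k(\hat{\mathbb P}_k)}\mathbb Q_k(\tilde\theta^\top x\le 0)$ is computed by the following formula: with $A_k=-\hat\theta_k^\top x$, $B_k=\sqrt{x^\top\hat\Sigma_k x}$, $C_k=\rho_k\|x\|_2$, $$f_k(x)=\begin{cases}1 & \text{if } A_k+C_k\ge 0,\\[2pt] \left(\dfrac{-A_kC_k+B_k\sqrt{A_k^2+B_k^2-C_k^2}}{A_k^2+B_k^2}\right)^2\in(0,1) & \text{if } A_k+C_k<0\end{cases}$$ (for $x\in\mathcal X$ the second case applies for every $k$).
   Context: $\tilde\theta$ denotes a random vector in $\mathbb R^d$; it is the parameter of a linear classifier, and the event that $x$ receives the unfavorable label $0$ is identified with $\{\tilde\theta^\top x\le 0\}$. Gelbrich distance: for $(\theta,\Sigma),(\hat\theta,\hat\Sigma)\in\mathbb R^d\times\mathbb S_+^d$ ($\mathbb S_+^d$ is the set of symmetric positive semidefinite $d\times d$ matrices), $$\mathbb G((\theta,\Sigma),(\hat\theta,\hat\Sigma))=\sqrt{\|\theta-\hat\theta\|_2^2+\mathrm{Tr}\big[\Sigma+\hat\Sigma-2(\hat\Sigma^{1/2}\Sigma\hat\Sigma^{1/2})^{1/2}\big]}.$$ Write $\mathbb Q_k\sim(\theta_k,\Sigma_k)$ if the probability distribution $\mathbb Q_k$ on $\mathbb R^d$ has mean $\theta_k$ and covariance matrix $\Sigma_k$. The nominal component $\hat{\mathbb P}_k$ has mean $\hat\theta_k$ and covariance $\hat\Sigma_k$; the nominal distribution $\hat{\mathbb P}$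 is the mixture of the $\hat{\mathbb P}_k$ with weights $\hat p_k$; and $$\mathcal B_k(\hat{\mathbb P}_k)=\{\mathbb Q_k:\ \mathbb Q_k\sim(\theta_k,\Sigma_k),\ \mathbb G((\theta_k,\Sigma_k),(\hat\theta_k,\hat\Sigma_k))\le\rho_k\},$$ with no parametric form imposed on $\mathbb Q_k$. $\phi$-divergence: $\phi:\mathbb R\to\mathbb R$ is a convex function on the domain $\mathbb R_+$, with $\phi(1)=0$, and with the conventions $0\times\phi(a/0)=a\times\lim_{t\uparrow\infty}\phi(t)/t$ for $a>0$ and $0\times\phi(0/0)=0$. For probability vectors $p,\hat p\in\mathbb R_+^K$, $\mathbb D_\phi(p\,\|\,\hat p)=\sum_{k=1}^K\hat p_k\,\phi(p_k/\hat p_k)$. The conjugate function $\phi^*:\mathbb R\to\mathbb R\cup\{\infty\}$ is $\phi^*(s)=\sup_{t\ge0}\{ts-\phi(t)\}$. Weight uncertainty set: $\Delta=\{p\in[0,1]^K:\ \sum_{k=1}^K p_k=1,\ \mathbb D_\phi(p\,\|\,\hat p)\le\varepsilon\}$. The ambiguity set $\mathcal U(\hat{\mathbb P})$ is the set of all mixture distributions $\mathbb Q=\sum_{k=1}^K p_k\mathbb Q_k$ with $p\in\Delta$ and $\mathbb Q_k\in\mathcal B_k(\hat{\mathbb P}_k)$ for all $k\in\{1,\dots,K\}$.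
   Formalization: For ε=0 the ''min'' over (λ,η) is proved only as an infimum (it need not be attained, e.g. φ(t)=(t−1)²); it is attained for ε>0. Terms with λ=0 are read by the recession function, and 0·φ* for p̂_k=0 as the conjugate of t↦0·φ(t/0). *)

(* Defs.v *)
From mathcomp Require Import all_boot all_order all_algebra.
From mathcomp Require Import all_classical all_reals all_analysis.

Set Implicit Arguments.
Unset Strict Implicit.
Unset Printing Implicit Defensive.

Import Order.TTheory GRing.Theory Num.Theory.
Import numFieldNormedType.Exports.

Local Open Scope classical_set_scope.
Local Open Scope ring_scope.

Definition dotv (R : realType) (d : nat) (u v : 'cV[R]_d) : R :=
  (u^T *m v) 0 0.

(* The library norm on matrices is the sup norm. *)
Definition norm2 (R : realType) (d : nat) (u : 'cV[R]_d) : R :=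
  Num.sqrt (dotv u u).

Definition quadform (R : realType) (d : nat) (S : 'M[R]_d) (u : 'cV[R]_d) : R :=
  dotv u (S *m u).

Definition psdmx (R : realType) (d : nat) (S : 'M[R]_d) : Prop :=
  S^T = S /\ forall u, 0 <= quadform S u.

Definition posdefmx (R : realType) (d : nat) (S : 'M[R]_d) : Prop :=
  S^T = S /\ forall u, u != 0 -> 0 < quadform S u.

(* The unique positive semidefinite square root; junk if S is not positive
   semidefinite. *)
Definition sqrtmx (R : realType) (d : nat) (S : 'M[R]_d) : 'M[R]_d :=
  xget 0 [set T | psdmx T /\ T *m T = S].

Definition gelbrich (R : realType) (d : nat) (m : 'cV[R]_d) (S : 'M[R]_d)
    (m' : 'cV[R]_d) (S' : 'M[R]_d) : R :=
  Num.sqrt (norm2 (m - m') ^+ 2 +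
    \tr (S + S' - 2 *: sqrtmx (sqrtmx S' *m S *m sqrtmx S'))).

(* R^d with its Borel sigma-algebra. *)
Notation borel_vec R d := (g_sigma_algebraType (@open 'cV[R]_d)).

Definition vec_prob (R : realType) (d : nat) := probability (borel_vec R d) R.

Definition coordv (R : realType) (d : nat) (i : 'I_d) : borel_vec R d -> R :=
  fun t => (t : 'cV[R]_d) i 0.

(* Square integrability of the coordinates makes the mean and the covariance
   well defined. *)
Definition has_mean_cov (R : realType) (d : nat) (Q : vec_prob R d)
    (m : 'cV[R]_d) (S : 'M[R]_d) : Prop :=
  [/\ forall i, coordv (R := R) i \in Lfun Q 2%:E,
      forall i, 'E_Q[coordv (R := R) i]%E = (m i 0)%:E &
      forall i j, covariance Q (coordv i) (coordv j) = (S i j)%:E].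

Definition gelbrich_ball (R : realType) (d : nat) (mhat : 'cV[R]_d)
    (Shat : 'M[R]_d) (rho : R) : set (vec_prob R d) :=
  [set Q | exists (m : 'cV[R]_d) (S : 'M[R]_d),
    [/\ psdmx S, has_mean_cov Q m S & gelbrich m S mhat Shat <= rho]].

Definition unfavorable (R : realType) (d : nat) (x : 'cV[R]_d) :
    set (borel_vec R d) :=
  [set t | dotv (t : 'cV[R]_d) x <= 0].

Definition worst_prob (R : realType) (d : nat) (B : set (vec_prob R d))
    (x : 'cV[R]_d) : \bar R :=
  ereal_sup [set Q (unfavorable x) | Q in B].

(* lim_(t -> +oo) phi t / t; it exists in \bar R when phi is convex on R_+. *)
Definition phi_slope (R : realType) (phi : R -> R) : \bar R :=
  lim ((phi t / t)%:E @[t --> +oo%R]).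

(* q * phi (p / q), for p, q >= 0, with the conventions
   0 * phi (p / 0) = p * phi_slope phi if p > 0 and 0 * phi (0 / 0) = 0. *)
Definition phi_persp (R : realType) (phi : R -> R) (q p : R) : \bar R :=
  if q == 0 then (if p == 0 then 0%E else (p%:E * phi_slope phi)%E)
  else (q * phi (p / q))%:E.

Definition phi_div (R : realType) (K : nat) (phi : R -> R)
    (p phat : 'I_K -> R) : \bar R :=
  (\sum_(k < K) phi_persp phi (phat k) (p k))%E.

Definition weight_set (R : realType) (K : nat) (phi : R -> R) (eps : R)
    (phat : 'I_K -> R) : set ('I_K -> R) :=
  [set p | [/\ forall k, 0 <= p k <= 1, \sum_(k < K) p k = 1 &
               (phi_div phi p phat <= eps%:E)%E]].

Definition is_mixture (R : realType) (d K : nat) (p : 'I_K -> R)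
    (Qs : 'I_K -> vec_prob R d) (Q : vec_prob R d) : Prop :=
  forall A, measurable A -> Q A = (\sum_(k < K) (p k)%:E * Qs k A)%E.

Definition ambiguity_set (R : realType) (d K : nat)
    (mhat : 'I_K -> 'cV[R]_d) (Shat : 'I_K -> 'M[R]_d) (rho : 'I_K -> R)
    (phi : R -> R) (eps : R) (phat : 'I_K -> R) : set (vec_prob R d) :=
  [set Q | exists (p : 'I_K -> R) (Qs : 'I_K -> vec_prob R d),
    [/\ weight_set phi eps phat p,
        forall k, gelbrich_ball (mhat k) (Shat k) (rho k) (Qs k) &
        is_mixture p Qs Q]].

Definition phi_conj (R : realType) (phi : R -> R) (s : R) : \bar R :=
  ereal_sup [set (t * s - phi t)%:E | t in [set t : R | 0 <= t]].

(* q * phi^*(s).  For q = 0 the product is read as the conjugate of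
   t |-> 0 * phi (t / 0), just as for q > 0 it is the conjugate of
   t |-> q * phi (t / q): its value is 0 if s <= phi_slope phi and +oo
   otherwise. *)
Definition wphi_conj (R : realType) (phi : R -> R) (q s : R) : \bar R :=
  if q == 0%R
  then ereal_sup [set ((t * s)%:E - phi_persp phi 0 t)%E
                 | t in [set t : R | 0 <= t]]
  else (q%:E * phi_conj phi s)%E.

(* The usual reading of lambda * q * phi^*(u / lambda) at lambda = 0, i.e. the
   recession function of q * phi^*, which is the support function of the domain
   of t |-> q * phi (t / q).  For q > 0 its value is 0 if u <= 0 and +oo
   otherwise. *)
Definition wphi_conj_rec (R : realType) (phi : R -> R) (q u : R) : \bar R :=
  ereal_sup [set (t * u)%:E
            | t in [set t : R | 0 <= t /\ (phi_persp phi q t < +oo)%E]].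

Definition dual_obj (R : realType) (K : nat) (phi : R -> R) (eps : R)
    (phat f : 'I_K -> R) (z : R * R) : \bar R :=
  let: (lambda, eta) := z in
  ((eta + eps * lambda)%:E +
   if lambda == 0%R
   then \sum_(k < K) wphi_conj_rec phi (phat k) (f k - eta)
   else lambda%:E *
        \sum_(k < K) wphi_conj phi (phat k) ((f k - eta) / lambda))%E.

Definition dual_dom (R : realType) : set (R * R) := [set z | 0 <= z.1].

(* The library's convex_function only covers real-valued functions. *)
Definition convex_ereal_on (R : realType) (D : set (R * R))
    (g : R * R -> \bar R) : Prop :=
  forall z z' (t : R), D z -> D z' -> 0 <= t <= 1 ->
    (g (t *: z.1 + (1 - t) *: z'.1, t *: z.2 + (1 - t) *: z'.2)%R
     <= t%:E * g z + (1 - t)%:E * g z')%E.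

Definition feasible_set (R : realType) (d K : nat) (X : set 'cV[R]_d)
    (c : 'cV[R]_d -> 'cV[R]_d -> R) (x0 : 'cV[R]_d) (delta : R)
    (mhat : 'I_K -> 'cV[R]_d) (Shat : 'I_K -> 'M[R]_d) (rho : 'I_K -> R) :
    set 'cV[R]_d :=
  [set x | [/\ X x, c x x0 <= delta &
    forall k,
      (worst_prob (gelbrich_ball (mhat k) (Shat k) (rho k)) x < 1)%E]].

Definition robust_set (R : realType) (d K : nat) (X : set 'cV[R]_d)
    (c : 'cV[R]_d -> 'cV[R]_d -> R) (x0 : 'cV[R]_d) (delta : R)
    (mhat : 'I_K -> 'cV[R]_d) (rho : 'I_K -> R) : set 'cV[R]_d :=
  [set x | [/\ X x, c x x0 <= delta &
    forall k, - dotv (mhat k) x + rho k * norm2 x < 0]].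

(* Main.v *)
(** A law with mean m, covariance S and m . x > 0 gives the half-space {theta . x <= 0}
mass at most sigma^2 / (sigma^2 + mu^2), where mu = m . x and sigma^2 = x^T S x
(Cantelli), and a law putting theta . x on two points attains this bound. Moving (m, S)
inside the Gelbrich ball keeps (mu, sigma) in the disc of center
(mhat . x, sqrt (x^T Shat x)) and radius rho |x|, and reaches the point where the
steepest line through the origin touches it. The worst case is the squared sine of the
angle of this line; it is 1 when the disc reaches mu <= 0.

The worst mixture then maximizes a linear payoff over the weights with bounded
divergence. For eps > 0 the weights phat (1 + tau), phat (1 - tau) and phat play the
role of Slater points and yield the two multipliers. For eps = 0, where the dual value
need not be attained, compactness of the simplex shows that the primal value is right
continuous in eps. *)

From HB Require Import structures.
Require Import Defs.
From mathcomp Require Import all_boot all_order all_algebra.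
From mathcomp Require Import all_classical all_reals all_analysis.
From mathcomp Require Import measurable_realfun ring lra.
From mathcomp Require complex.

Set Implicit Arguments.
Unset Strict Implicit.
Unset Printing Implicit Defensive.

Import Order.TTheory GRing.Theory Num.Theory.
Import numFieldNormedType.Exports.

Local Open Scope classical_set_scope.
Local Open Scope ring_scope.

(** * Positive semidefinite matrices *)

(** On the probabilistic side only the projection of a law on [x] matters. Staying in the disc
    follows from a matrix [L] that realizes the Gelbrich distance; only [Shat] is inverted to build
    it, so the competing covariance may be singular. Reaching the contact point uses covariances
    [M Shat M], for which the inner square root is explicit. On the dual side, [phi] is merely
    convex on the half-line and may jump up at 0. The divergence is then not lower semicontinuous,
    and a limit of weights whose divergence tends to 0 can have positive divergence; this is why a
    bare compactness argument does not suffice. A component of nominal weight 0 contributes either a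
    linear function or a constraint that its weight vanish; separating these cases once lets the
    later estimates run on real numbers with an explicit domain. Both branches of the dual objective
    are suprema of functions affine in the multipliers, which gives convexity and weak duality term
    by term. Strong duality needs no separation theorem in higher dimension: each multiplier is a
    number squeezed between two families of slopes. *)

Section inner_product.
Variables (R : realType) (d : nat).
Implicit Types (u v w x : 'cV[R]_d) (S T M : 'M[R]_d).

Lemma dotvE u v : dotv u v = \sum_i u i 0 * v i 0.
Proof. by rewrite /dotv mxE; apply: eq_bigr => i _; rewrite mxE. Qed.

Lemma dotvC u v : dotv u v = dotv v u.
Proof. by rewrite !dotvE; apply: eq_bigr => i _; rewrite mulrC. Qed.

Lemma dotvDl u v w : dotv (u + v) w = dotv u w + dotv v w.
Proof. by rewrite /dotv linearD /= mulmxDl mxE. Qed.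

Lemma dotvDr u v w : dotv w (u + v) = dotv w u + dotv w v.
Proof. by rewrite dotvC dotvDl ![dotv _ w]dotvC. Qed.

Lemma dotvZl a u v : dotv (a *: u) v = a * dotv u v.
Proof. by rewrite /dotv linearZ /= -scalemxAl mxE. Qed.

Lemma dotvZr a u v : dotv u (a *: v) = a * dotv u v.
Proof. by rewrite dotvC dotvZl dotvC. Qed.

Lemma dotvNl u v : dotv (- u) v = - dotv u v.
Proof. by rewrite -scaleN1r dotvZl mulN1r. Qed.

Lemma dotvBl u v w : dotv (u - v) w = dotv u w - dotv v w.
Proof. by rewrite dotvDl dotvNl. Qed.

Lemma dotvBr u v w : dotv w (u - v) = dotv w u - dotv w v.
Proof. by rewrite dotvC dotvBl ![dotv _ w]dotvC. Qed.

Lemma dotv_mulmx M u v : dotv (M *m u) v = dotv u (M^T *m v).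
Proof. by rewrite /dotv trmx_mul mulmxA. Qed.

Lemma dotv_ge0 u : 0 <= dotv u u.
Proof. by rewrite dotvE; apply: sumr_ge0 => i _; rewrite -expr2 sqr_ge0. Qed.

Lemma dotv_eq0 u : (dotv u u == 0) = (u == 0).
Proof.
apply/idP/eqP => [|->]; last by rewrite dotvE big1 // => i _; rewrite mxE mul0r.
rewrite dotvE psumr_eq0 => [/allP u0|i _]; last by rewrite -expr2 sqr_ge0.
apply/matrixP => i j; rewrite ord1 mxE.
by have := u0 i (mem_index_enum _); rewrite -expr2 sqrf_eq0 => /eqP.
Qed.

Lemma dotv_gt0 u : u != 0 -> 0 < dotv u u.
Proof. by rewrite -dotv_eq0 lt0r dotv_ge0 andbT. Qed.

Lemma sqr_norm2 u : norm2 u ^+ 2 = dotv u u.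
Proof. by rewrite sqr_sqrtr // dotv_ge0. Qed.

Lemma norm2_gt0 u : u != 0 -> 0 < norm2 u.
Proof. by move=> u0; rewrite sqrtr_gt0 dotv_gt0. Qed.

Lemma dotv_CauchySchwarz u v : dotv u v ^+ 2 <= dotv u u * dotv v v.
Proof.
have [->|v0] := eqVneq v 0.
  have -> : dotv u 0 = 0 by rewrite dotvE big1 // => i _; rewrite mxE mulr0.
  by rewrite expr0n mulr_ge0 // dotv_ge0.
have vv := dotv_gt0 v0.
have := dotv_ge0 (dotv v v *: u - dotv u v *: v).
rewrite !(dotvBl, dotvBr, dotvZl, dotvZr) (dotvC v u) => h.
rewrite -subr_ge0 -(pmulr_rge0 _ vv).
by lra.
Qed.

Lemma quadformE S u : quadform S u = (u^T *m S *m u) 0 0.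
Proof. by rewrite /quadform /dotv mulmxA. Qed.

Lemma psdmx_gram (L : 'M[R]_d) : psdmx (L^T *m L).
Proof.
split=> [|u]; first by rewrite trmx_mul trmxK.
by rewrite /quadform -mulmxA dotvC dotv_mulmx trmxK dotv_ge0.
Qed.

Lemma psdmx_conj S M : psdmx S -> M^T = M -> psdmx (M *m S *m M).
Proof.
move=> [sS pS] sM; split=> [|u]; first by rewrite !trmx_mul sS sM mulmxA.
by have := pS (M *m u); rewrite /quadform dotv_mulmx sM !mulmxA.
Qed.

Lemma posdef_psdmx S : posdefmx S -> psdmx S.
Proof.
move=> [sS pS]; split=> // u; have [->|/pS/ltW //] := eqVneq u 0.
by rewrite /quadform dotvE big1 // => i _; rewrite mxE mul0r.
Qed.

Lemma posdefmx_unit S : posdefmx S -> S \in unitmx.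
Proof.
move=> [sS pS]; rewrite -row_free_unit; apply/inj_row_free => v vS.
apply/eqP; rewrite -trmx_eq0; apply/negP => /negP /pS.
by rewrite quadformE trmxK vS mul0mx mxE ltxx.
Qed.

Lemma psdmx_mul_eq0 S u : psdmx S -> quadform S u = 0 -> S *m u = 0.
Proof.
move=> [sS pS] Su0; set v := S *m u.
apply/eqP; rewrite -dotv_eq0; apply/eqP.
(* the quadratic polynomial t |-> quadform S (u - t v) is nonnegative *)
have key t : 0 <= - t * (dotv v v) *+ 2 + t ^+ 2 * quadform S v.
  have uSv : dotv u (S *m v) = dotv v v by rewrite -{1}sS -dotv_mulmx.
  have := pS (u - t *: v); rewrite /quadform mulmxBr -scalemxAr -/v.
  rewrite !(dotvBl, dotvBr, dotvZl, dotvZr) uSv.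
  by move: Su0; rewrite /quadform -/v => ->; lra.
have qv := pS v.
(* The exact minimizer would divide by [quadform S v], which may vanish; adding 1 keeps the quotient
   defined, and the value is still negative unless [v] is zero. *)
have := key (dotv v v / (quadform S v + 1)).
have q1 : 0 < quadform S v + 1 by lra.
set a := dotv v v in key *; set q := quadform S v in qv q1 *.
have a0 : 0 <= a by exact: dotv_ge0.
move=> h; apply/eqP; rewrite eq_le a0 andbT leNgt; apply/negP => agt.
move: h; rewrite leNgt => /negP; apply.
have -> : - (a / (q + 1)) * a *+ 2 + (a / (q + 1)) ^+ 2 * q =
   - (a ^+ 2 * (q + 2) / (q + 1) ^+ 2) by field; rewrite gt_eqF.
by rewrite oppr_lt0 divr_gt0 ?exprn_gt0 // mulr_gt0 ?exprn_gt0 //; lra.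
Qed.

(** The trace is the sum of the quadratic form over the columns of [M]; its terms are nonnegative,
    so each one vanishes. *)
Lemma psdmx_mul_gram_eq0 S M : psdmx S -> \tr (M^T *m S *m M) = 0 -> S *m M = 0.
Proof.
move=> pS; rewrite /mxtrace => tr0.
have colM i : S *m col i M = col i (S *m M) by rewrite !colE mulmxA.
have diag i : (M^T *m S *m M) i i = quadform S (col i M).
  rewrite quadformE tr_col -!mulmxA colM mxE [RHS]mxE.
    by apply: eq_bigr => j _; rewrite !mxE.
have col0 i : S *m col i M = 0.
  apply: psdmx_mul_eq0 => //; move/eqP: tr0.
  rewrite psumr_eq0 => [/allP/(_ i (mem_index_enum _))/eqP|j _].
    by rewrite diag.
  by rewrite diag; case: pS.
by apply/matrixP => i j; have /matrixP/(_ i 0) := col0 j; rewrite colM !mxE.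
Qed.

(* D = T - T' satisfies T D + D T' = 0, so tr (D T D) + tr (D T' D) = 0, which
   forces T D = T' D = 0 and D^2 = 0. *)
Lemma psdmx_sqrt_unique T T' : psdmx T -> psdmx T' -> T *m T = T' *m T' -> T = T'.
Proof.
move=> pT pT' TT; pose D := T - T'.
have sD : D^T = D by rewrite /D linearB /=; case: pT => ->; case: pT' => ->.
have eqD : T *m D = - (D *m T').
  by rewrite /D mulmxBr mulmxBl TT opprB.
have tr0 : \tr (D^T *m T *m D) + \tr (D^T *m T' *m D) = 0.
  rewrite sD -mulmxA eqD mulmxN mxtrace_mulC [X in _ + X]mxtrace_mulC.
  by rewrite linearN /= -!mulmxA [X in - X]mxtrace_mulC -!mulmxA addNr.
have ge0 S : psdmx S -> 0 <= \tr (D^T *m S *m D).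
  move=> pS; rewrite sD; apply: sumr_ge0 => i _.
  have [_ /(_ (delta_mx i 0))] := psdmx_conj pS sD.
  by rewrite quadformE trmx_delta -rowE -colE !mxE.
have := ge0 T pT; have := ge0 T' pT' => h1 h2.
have TD : T *m D = 0 by apply: psdmx_mul_gram_eq0 => //; lra.
have T'D : T' *m D = 0 by apply: psdmx_mul_gram_eq0 => //; lra.
have DD : D *m D = 0 by rewrite {1}/D mulmxBl TD T'D subrr.
have : \tr (D^T *m 1%:M *m D) = 0 by rewrite mulmx1 sD DD mxtrace0.
move/psdmx_mul_gram_eq0; rewrite mul1mx => /(_ _)/eqP; rewrite subr_eq0 => h.
apply/eqP/h; have := psdmx_gram (1%:M : 'M[R]_d).
by rewrite trmx1 mulmx1.
Qed.

End inner_product.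

(** Newton interpolation: a new node is corrected by a multiple of the polynomial vanishing at the
    earlier ones. Repeated nodes are allowed, as eigenvalues may be multiple. *)
Lemma poly_interpolation (F : fieldType) (h : F -> F) (s : seq F) :
  exists q : {poly F}, forall a, a \in s -> q.[a] = h a.
Proof.
elim: s => [|b s [q qP]]; first by exists 0 => a.
pose r := \prod_(c <- s) ('X - c%:P).
have r0 c : c \in s -> r.[c] = 0 by move=> cs; apply/rootP; rewrite root_prod_XsubC.
have [bs|bs] := boolP (b \in s).
  by exists q => a; rewrite inE => /orP[/eqP ->|]; apply: qP.
exists (q + ((h b - q.[b]) / r.[b])%:P * r) => a.
rewrite inE hornerD hornerM hornerC => /orP[/eqP ->|As].
  rewrite divfK; first by rewrite addrC subrK.
  apply: contra bs => /eqP rb.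
  by rewrite -root_prod_XsubC; apply/rootP.
by rewrite (r0 a) // mulr0 addr0 qP.
Qed.

Lemma trmx_horner_mx (F : comNzRingType) n (A : 'M[F]_n.+1) (p : {poly F}) :
  A^T = A -> (horner_mx A p)^T = horner_mx A p.
Proof.
move=> sA; elim/poly_ind: p => [|p c IH]; first by rewrite raddf0 trmx0.
rewrite raddfD /= rmorphM /= horner_mx_X horner_mx_C linearD /= tr_scalar_mx.
congr (_ + _); rewrite -[_ * A]/(_ *m A) trmx_mul sA IH.
exact: (esym (comm_horner_mx p (erefl (A *m A)))).
Qed.

(** The diagonalization lives over [K], the matrix and the polynomial over [F], and injectivity of
    [map_mx] brings the identity back. It serves a real symmetric matrix diagonalized over the
    complex numbers. *)
Lemma horner_mx_diagonalizable (F K : fieldType) (f : {rmorphism F -> K}) n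
    (S : 'M[F]_n.+1) (P : 'M[K]_n.+1) (lam : 'I_n.+1 -> F) (p : {poly F}) :
  P \in unitmx ->
  map_mx f S = invmx P *m diag_mx (\row_i f (lam i)) *m P ->
  (forall i, p.[lam i] = lam i) -> horner_mx S p = S.
Proof.
move=> uP eqS pP; apply: (map_mx_inj (f := f)).
rewrite map_horner_mx eqS horner_mx_uconjC // horner_mx_diag.
congr (_ *m diag_mx _ *m _); apply/rowP => i.
by rewrite !mxE horner_map /= pP.
Qed.

Section psd_sqrt.
Import complex.
Variables (R : realType) (d : nat).
Implicit Types (S : 'M[R]_d).

Lemma psdmx_char_root_ge0 S a : psdmx S -> root (char_poly S) a -> 0 <= a.
Proof.
move=> [_ pS]; rewrite -eigenvalue_root_char => /eigenvalueP [v vS v0].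
have v0' : v^T != 0 by rewrite trmx_eq0.
have := pS v^T; rewrite quadformE trmxK vS -scalemxAl mxE.
rewrite pmulr_lge0 //; have := dotv_gt0 v0'; by rewrite /dotv trmxK.
Qed.

(* T = q(S)^2, where q interpolates the fourth root on the spectrum of S. *)
Lemma psdmx_sqrt_exists S : psdmx S -> exists T, psdmx T /\ T *m T = S.
Proof.
move=> pS; case: (pS) => sS _.
pose toC : {rmorphism R -> R[i]} := real_complex R.
pose SC := map_mx toC S.
have hS : SC \is hermsymmx.
  apply/is_hermitianmxP; rewrite expr0 scale1r.
  apply/matrixP => i j; rewrite !mxE -{1}sS mxE.
  by rewrite (CrealP _) //; apply/complex_realP; exists (S j i).
have /orthomx_spectralP := hermitian_normalmx hS.
have rD := hermitian_spectral_diag_real hS.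
set P := spectralmx SC; set D := spectral_diag SC => eqS.
have uP : P \in unitmx by exact: spectral_unit.
pose lam i := Re (D 0 i).
have lamE i : toC (lam i) = D 0 i by apply/RRe_real/mxOverP.
have lam_ge0 i : 0 <= lam i.
  apply: (psdmx_char_root_ge0 pS).
  rewrite -(fmorph_root toC) lamE map_char_poly -eigenvalue_root_char.
  apply/eigenvalueP; exists (row i P).
    rewrite -row_mul -/SC eqS !mulmxA mulmxV // mul1mx.
    by rewrite row_mul row_diag_mx -scalemxAl -rowE.
  apply/eqP => rP0; move: uP; rewrite -row_free_unit => /row_freeP [B PB].
  move/matrixP: PB => /(_ i i); rewrite !mxE eqxx.
  move=> /eqP; rewrite big1 ?(eq_sym 0) ?oner_eq0 // => j _.
  by move/matrixP: rP0 => /(_ 0 j); rewrite !mxE => ->; rewrite !mul0r.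
(* With the fourth root, the candidate is [L *m L] for a symmetric [L], hence a Gram matrix: its
   positivity requires no knowledge of the spectrum of [L]. *)
have [q qP] := poly_interpolation (fun a => Num.sqrt (Num.sqrt a)) [seq lam i | i : 'I_d].
(* [horner_mx] asks for a nonzero size, so size 0 is treated apart. *)
case: d => [|n] in S pS sS SC hS P D eqS rD uP lam lamE lam_ge0 qP *.
  exists 0; split; last by apply/matrixP => - [].
  by split=> [|u]; [rewrite trmx0|rewrite /quadform mul0mx dotvE big_ord0].
pose L := horner_mx S q.
have sL : L^T = L by exact: trmx_horner_mx.
exists (L *m L); split; first by rewrite -{1}sL; exact: psdmx_gram.
have -> : L *m L *m (L *m L) = horner_mx S (q ^+ 4).
  by rewrite rmorphXn -!mulmxA.
have H := @horner_mx_diagonalizable R R[i] toC n S P lam (q ^+ 4) uP.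
apply: H.
  rewrite -/SC; have -> : \row_i toC (lam i) = D by apply/rowP => i; rewrite mxE lamE.
  exact: eqS.
move=> i; rewrite horner_exp.
transitivity ((q.[lam i] ^+ 2) ^+ 2); first by rewrite -exprM.
rewrite qP; first by rewrite !sqr_sqrtr ?sqrtr_ge0.
by apply/mapP; exists i; rewrite ?mem_enum.
Qed.
End psd_sqrt.

(** * The Gelbrich distance *)

Section gelbrich_distance.
Variables (R : realType) (d : nat).
Implicit Types (m u x : 'cV[R]_d) (S M : 'M[R]_d).

Lemma sqrtmxP S : psdmx S -> psdmx (sqrtmx S) /\ sqrtmx S *m sqrtmx S = S.
Proof.
by move=> /psdmx_sqrt_exists [T TP]; rewrite /sqrtmx; case: xgetP => [T' _ //|/(_ T)].
Qed.

Lemma sqrtmxE S T : psdmx T -> T *m T = S -> sqrtmx S = T.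
Proof.
move=> pT TT; have pS : psdmx S by rewrite -TT -{1}(proj1 pT); exact: psdmx_gram.
have [pQ QQ] := sqrtmxP pS; apply: psdmx_sqrt_unique => //; by rewrite QQ TT.
Qed.

Definition frobenius2 M : R := \tr (M^T *m M).

Lemma frobenius2E M : frobenius2 M = \sum_i dotv (row i M)^T (row i M)^T.
Proof.
rewrite /frobenius2 mxtrace_mulC; apply: eq_bigr => i _.
by rewrite dotvE mxE; apply: eq_bigr => j _; rewrite !mxE.
Qed.

Lemma frobenius2_ge0 M : 0 <= frobenius2 M.
Proof. by rewrite frobenius2E; apply: sumr_ge0 => i _; exact: dotv_ge0. Qed.

Lemma dotv_mulmx_frobenius M x : dotv (M *m x) (M *m x) <= frobenius2 M * dotv x x.
Proof.
rewrite frobenius2E mulr_suml [leLHS]dotvE; apply: ler_sum => i _.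
rewrite -expr2; have -> : (M *m x) i 0 = dotv (row i M)^T x.
  by rewrite /dotv trmxK -row_mul [RHS]mxE.
exact: dotv_CauchySchwarz.
Qed.

(* With P = Shat^(1/2) and T = (P S P)^(1/2), the matrix L = T P^-1 satisfies
   L^T L = S and tr (L^T P) = tr T: it realizes the optimal coupling. *)
Lemma gelbrich_coupling S Shat : psdmx S -> posdefmx Shat ->
  exists L, [/\ L^T *m L = S,
    \tr (S + Shat - 2 *: sqrtmx (sqrtmx Shat *m S *m sqrtmx Shat)) =
      frobenius2 (L - sqrtmx Shat)
    & forall x, dotv (sqrtmx Shat *m x) (sqrtmx Shat *m x) = quadform Shat x].
Proof.
move=> pS pSh; have [pP PP] := sqrtmxP (posdef_psdmx pSh).
set P := sqrtmx Shat in pP PP *; case: (pP) => sP _.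
have uP : P \in unitmx.
  by have := posdefmx_unit pSh; rewrite -PP unitmx_mul => /andP[].
have [] := sqrtmxP (psdmx_conj pS sP); set T := sqrtmx _ => -[sT _] TT.
have siP : (invmx P)^T = invmx P by rewrite trmx_inv sP.
have sL : (T *m invmx P)^T = invmx P *m T by rewrite trmx_mul sT siP.
exists (T *m invmx P); split.
- by rewrite sL !mulmxA -(mulmxA _ T T) TT !mulmxA mulVmx // mul1mx mulmxK.
- rewrite /frobenius2 [(_ - _)^T]linearB /= sL sP mulmxBl !mulmxBr.
  have -> : invmx P *m T *m (T *m invmx P) = S.
    by rewrite !mulmxA -(mulmxA _ T T) TT !mulmxA mulVmx // mul1mx mulmxK.
  rewrite PP !raddfB /= mxtraceD mxtraceZ.
  rewrite -[\tr (invmx P *m T *m P)]mxtrace_mulC mulmxA mulmxV // mul1mx.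
  by rewrite [\tr (P *m _)]mxtrace_mulC -mulmxA mulVmx // mulmx1; ring.
- by move=> x; rewrite dotv_mulmx sP /quadform mulmxA PP.
Qed.

(** With the coupling [L], the two deviations are the lengths of [L x] and [Shat^(1/2) x]. They
    differ by at most the length of [(L - Shat^(1/2)) x], which the Frobenius norm controls; the
    means are handled by Cauchy-Schwarz. *)
Lemma gelbrich_proj m S mhat Shat x : psdmx S -> posdefmx Shat ->
  (dotv m x - dotv mhat x) ^+ 2
    + (Num.sqrt (quadform S x) - Num.sqrt (quadform Shat x)) ^+ 2
  <= (gelbrich m S mhat Shat * norm2 x) ^+ 2.
Proof.
move=> pS pSh; have [L [LL trE Px]] := gelbrich_coupling pS pSh.
rewrite exprMn sqr_norm2 /gelbrich trE sqr_norm2 sqr_sqrtr; last first.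
  by rewrite addr_ge0 ?dotv_ge0 ?frobenius2_ge0.
rewrite mulrDl lerD //; first by rewrite -dotvBl; exact: dotv_CauchySchwarz.
apply: le_trans (dotv_mulmx_frobenius _ _).
have Lx : dotv (L *m x) (L *m x) = quadform S x by rewrite dotv_mulmx mulmxA LL.
rewrite mulmxBl !(dotvBl, dotvBr) Lx Px (dotvC (sqrtmx _ *m x)).
set a := L *m x in Lx *; set b := sqrtmx Shat *m x in Px *.
have qS : 0 <= quadform S x by case: pS.
have qSh : 0 <= quadform Shat x by case: (posdef_psdmx pSh).
have : dotv a b <= Num.sqrt (quadform S x) * Num.sqrt (quadform Shat x).
  rewrite -sqrtrM // -Lx -Px; apply: le_trans (ler_norm _) _.
  by rewrite -sqrtr_sqr ler_sqrt ?mulr_ge0 ?dotv_ge0 // dotv_CauchySchwarz.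
move=> ab; rewrite sqrrB !sqr_sqrtr //; move: ab; clear; lra.
Qed.

(** With [P = Shat^(1/2)], the matrix [P (M Shat M) P] is the square of [P M P], itself positive
    semidefinite; uniqueness of the root then makes the distance explicit. *)
Lemma gelbrich_conj m mhat Shat M : posdefmx Shat -> psdmx M ->
  gelbrich m (M *m Shat *m M) mhat Shat =
  Num.sqrt (dotv (m - mhat) (m - mhat)
            + \tr ((M - 1%:M) *m Shat *m (M - 1%:M))).
Proof.
move=> pSh pM; have [pP PP] := sqrtmxP (posdef_psdmx pSh).
rewrite /gelbrich sqr_norm2; set P := sqrtmx Shat in pP PP *.
case: (pP) => sP _.
have -> : sqrtmx (P *m (M *m Shat *m M) *m P) = P *m M *m P.
  apply: sqrtmxE; first exact: psdmx_conj.
  by rewrite -PP !mulmxA.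
congr (Num.sqrt (_ + _)).
rewrite !(mulmxBl, mulmxBr, mul1mx, mulmx1) !raddfB /= mxtraceD mxtraceZ.
have -> : \tr (P *m M *m P) = \tr (M *m Shat).
  by rewrite mxtrace_mulC mulmxA PP mxtrace_mulC.
by rewrite [\tr (Shat *m M)]mxtrace_mulC; ring.
Qed.

(* The witness is S = M Shat M with M = 1 + b x x^T. *)
Lemma gelbrich_shift mhat Shat a b x : posdefmx Shat -> 0 <= b ->
  exists S, [/\ psdmx S,
    quadform S x = (1 + b * dotv x x) ^+ 2 * quadform Shat x &
    gelbrich (mhat + a *: x) S mhat Shat =
      Num.sqrt (dotv x x * (a ^+ 2 + b ^+ 2 * quadform Shat x))].
Proof.
move=> pSh b0; pose N : 'M[R]_d := b *: (x *m x^T).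
have sN : N^T = N by rewrite /N linearZ /= trmx_mul trmxK.
have pM : psdmx (1%:M + N).
  split=> [|u]; first by rewrite linearD /= sN trmx1.
  rewrite /quadform mulmxDl mul1mx dotvDr addr_ge0 ?dotv_ge0 //.
  rewrite /N -scalemxAl dotvZr mulr_ge0 // -mulmxA.
  rewrite [x^T *m u]mx11_scalar -[(x^T *m u) 0 0]/(dotv x u) mul_mx_scalar.
  by rewrite dotvZr dotvC -expr2 sqr_ge0.
case: (pM) => sM _.
have Mx : (1%:M + N) *m x = (1 + b * dotv x x) *: x.
  rewrite mulmxDl mul1mx /N -scalemxAl -mulmxA [x^T *m x]mx11_scalar.
  by rewrite mul_mx_scalar scalerA scalerDl scale1r.
exists ((1%:M + N) *m Shat *m (1%:M + N)); split.
- exact: psdmx_conj (posdef_psdmx pSh) sM.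
- by rewrite /quadform -!mulmxA dotvC dotv_mulmx sM dotvC Mx -scalemxAr dotvZl dotvZr; ring.
- rewrite gelbrich_conj // (addrC mhat) addrK dotvZl dotvZr (addrC 1%:M) addrK.
  congr Num.sqrt; rewrite /N -!scalemxAl -!scalemxAr !linearZ /=.
  rewrite !mulmxA -(mulmxA _ x^T Shat) -(mulmxA _ (x^T *m Shat) x).
  rewrite [x^T *m Shat *m x]mx11_scalar -quadformE mul_mx_scalar -scalemxAl linearZ /=.
  by rewrite mxtrace_mulC /mxtrace big_ord1 -[(x^T *m x) 0 0]/(dotv x x); ring.
Qed.

End gelbrich_distance.

(** * Laws with given mean and covariance *)

Section borel_measurability.
Variables (R : realType) (d : nat).

Lemma measurable_borel_vec (f : 'cV[R]_d -> R) :
  continuous f -> measurable_fun [set: borel_vec R d] (f : borel_vec R d -> R).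
Proof.
move=> /continuousP cf; apply: (measurability _ (RGenOpens.measurableE R)).
move=> _ [_ [a [b ->] <-]]; rewrite setTI.
by apply: sub_sigma_algebra; exact/cf/interval_open.
Qed.

Lemma measurable_coordv i : measurable_fun setT (@coordv R d i).
Proof. by apply: measurable_borel_vec => t; exact: coord_continuous. Qed.

Lemma continuous_dotv (x : 'cV[R]_d) : continuous (fun t : 'cV[R]_d => dotv t x).
Proof.
rewrite (_ : (fun _ => _) = fun t : 'cV[R]_d => \sum_i t i 0 * x i 0); last first.
  by apply/funext => u; rewrite dotvE.
elim: (index_enum _) => [|i s IH].
  rewrite (_ : (fun _ => _) = cst 0); first exact: cst_continuous.
  by apply/funext => t; rewrite big_nil.
rewrite (_ : (fun _ => _) = (fun t : 'cV[R]_d => t i 0 * x i 0) \+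
    (fun t : 'cV[R]_d => \sum_(i <- s) t i 0 * x i 0)); last first.
  by apply/funext => t; rewrite big_cons.
move=> t; apply: (@cvgD R R _ (nbhs t)); last exact: IH.
by apply: (@cvgM _ _ (nbhs t)); [exact: coord_continuous|exact: cvg_cst].
Qed.

Lemma measurable_unfavorable (x : 'cV[R]_d) : measurable (unfavorable x).
Proof.
rewrite /unfavorable -[X in measurable X]setTI.
have /measurable_borel_vec mf := @continuous_dotv x.
have := mf measurableT _ (measurable_itv `]-oo, 0]).
by congr (measurable _); apply/seteqP; split=> t /=; rewrite in_itv /=.
Qed.
End borel_measurability.

(** * Finite mixtures and laws with finite support *)

Section mixture.
Context (dT : measure_display) (T : measurableType dT) (R : realType) (n : nat).
Variables (w : 'I_n -> {nonneg R}) (Q : 'I_n -> probability T R).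
Hypothesis w1 : \sum_k (w k)%:num = 1.

(** [msum] takes a sequence indexed by all naturals, hence the detour through [insub]; the zero
    measure stands only at indices outside the sum. *)
Let summand (k : nat) : {measure set T -> \bar R} :=
  if insub k is Some i then mscale (w i) (Q i) else mzero.

Let summandE (i : 'I_n) : summand i = mscale (w i) (Q i).
Proof. by rewrite /summand valK. Qed.

Definition mixture : set T -> \bar R := msum summand n.

HB.instance Definition _ := Measure.on mixture.

Lemma mixtureE A : mixture A = (\sum_k (w k)%:num%:E * Q k A)%E.
Proof. by apply: eq_bigr => i _; rewrite summandE. Qed.

Let mixture_setT : mixture setT = 1%E.
Proof.
rewrite mixtureE -[1%E]/(1%:E) -w1 -sumEFin.
by apply: eq_bigr => i _; rewrite probability_setT mule1.
Qed.

HB.instance Definition _ := Measure_isProbability.Build _ _ _ mixture mixture_setT.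

Lemma ge0_integral_mixture (f : T -> \bar R) :
  (forall t, 0 <= f t)%E -> measurable_fun setT f ->
  (\int[mixture]_t f t = \sum_k (w k)%:num%:E * \int[Q k]_t f t)%E.
Proof.
move=> f0 mf; rewrite ge0_integral_measure_sum //.
by apply: eq_bigr => i _; rewrite summandE ge0_integral_mscale.
Qed.

Definition mixture_probability : probability T R := mixture.

End mixture.

(** Used twice: with Dirac masses to build laws of finite support, and with laws of the balls to
    realize a mixture of the ambiguity set. *)
Lemma mixture_exists (dT : measure_display) (T : measurableType dT) (R : realType)
    n (w : 'I_n -> R) (Q : 'I_n -> probability T R) :
  (forall k, 0 <= w k) -> \sum_k w k = 1 ->
  exists P : probability T R,
    (forall A, P A = \sum_k (w k)%:E * Q k A)%E /\
    (forall f : T -> \bar R, (forall t, 0 <= f t)%E -> measurable_fun setT f ->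
      \int[P]_t f t = \sum_k (w k)%:E * \int[Q k]_t f t)%E.
Proof.
move=> w0 w1; pose v k := NngNum (w0 k).
have v1 : \sum_k (v k)%:num = 1 by [].
by exists (mixture_probability Q v1); split=> [A|f f0 mf];
  [exact: mixtureE|exact: ge0_integral_mixture].
Qed.

Lemma discrete_law (dT : measure_display) (T : measurableType dT) (R : realType)
    (I : finType) (w : I -> R) (pt : I -> T) :
  (forall i, 0 <= w i) -> \sum_i w i = 1 ->
  exists P : probability T R,
    (forall A, P A = \sum_i (w i)%:E * \d_(pt i) A)%E /\
    (forall f : T -> R, measurable_fun setT f ->
      P.-integrable setT (EFin \o f) /\
      (\int[P]_t (f t)%:E)%E = (\sum_i w i * f (pt i))%:E).
Proof.
move=> w0 w1.
have [||P [PE PI]] := @mixture_exists _ T R _ (fun k : 'I_#|I| => w (enum_val k))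
    (fun k => [the probability T R of \d_(pt (enum_val k))]).
- by move=> k.
- by rewrite -w1 [RHS](reindex _ (onW_bij _ (enum_val_bij I))).
have sumI (F : I -> \bar R) : (\sum_(k < #|I|) F (enum_val k) = \sum_i F i)%E.
  by rewrite [RHS](reindex _ (onW_bij _ (enum_val_bij I))).
exists P; split=> [A|f mf].
  by rewrite PE (sumI (fun i => (w i)%:E * \d_(pt i) A)%E).
have PIf (h : T -> R) : (forall t, 0 <= h t) -> measurable_fun setT h ->
    (\int[P]_t (h t)%:E = (\sum_i w i * h (pt i))%:E)%E.
  move=> h0 mh; rewrite PI //; last exact/measurable_EFinP.
  rewrite (sumI (fun i => (w i)%:E * \int[\d_(pt i)]_t (h t)%:E)%E) -sumEFin.
  apply: eq_bigr => i _; rewrite integral_dirac ?diracT ?mul1e //.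
  exact/measurable_EFinP.
have fin : P.-integrable setT (EFin \o f).
  apply/integrableP; split; first exact/measurable_EFinP.
  have /= -> := PIf (fun t => `|f t|) (fun t => normr_ge0 _)
    (measurableT_comp (@normr_measurable R setT) mf).
  exact: ltry.
split=> //; rewrite integralE.
have -> : funepos (fun t => (f t)%:E) = (fun t => (f^\+ t)%:E).
  exact: funerpos.
have -> : funeneg (fun t => (f t)%:E) = (fun t => (f^\- t)%:E).
  exact: funerneg.
rewrite (PIf f^\+) ?(PIf f^\-) -?EFinB.
- congr EFin; rewrite -sumrB; apply: eq_bigr => i _.
  by rewrite -mulrBr; congr (_ * _); rewrite -{3}(funrposBneg f).
- by move=> t; exact: funrneg_ge0.
- exact: measurable_funrneg.
- by move=> t; exact: funrpos_ge0.
- exact: measurable_funrpos.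
Qed.

Lemma integrable_sqr_Lfun2 (dT : measure_display) (T : measurableType dT)
    (R : realType) (mu : {measure set T -> \bar R}) (f : T -> R) :
  measurable_fun setT f -> mu.-integrable setT (EFin \o (fun t => f t ^+ 2)) ->
  f \in Lfun mu 2%:E.
Proof.
move=> mf /integrableP[_ foo]; rewrite inE; apply/andP; split; rewrite inE //=.
rewrite /finite_norm unlock /Lnorm; apply: poweR_lty.
apply: le_lt_trans foo; rewrite le_eqVlt; apply/orP; left; apply/eqP.
apply: eq_integral => t _ /=.
by rewrite normrX -powR_mulrn.
Qed.

Section finite_support_moments.
Variables (R : realType) (d : nat) (I : finType) (w : I -> R).
Variables (m : 'cV[R]_d) (S : 'M[R]_d) (y : I -> 'cV[R]_d).
Hypotheses (w0 : forall i, 0 <= w i) (w1 : \sum_i w i = 1).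
Hypothesis y_mean : forall j, \sum_i w i * y i j 0 = 0.
Hypothesis y_cov : forall j k, \sum_i w i * (y i j 0 * y i k 0) = S j k.

Lemma finite_support_law : exists Q : vec_prob R d, has_mean_cov Q m S /\
  forall A, Q A = (\sum_i (w i)%:E * \d_((m + y i)%R : borel_vec R d) A)%E.
Proof.
have [Q [QE QI]] := discrete_law (fun i => (m + y i : borel_vec R d)) w0 w1.
exists Q; split=> //.
have mc i := @measurable_coordv R d i.
have meanE i : 'E_Q[coordv (R := R) i]%E = (m i 0)%:E.
  rewrite unlock (QI _ (mc i)).2 /coordv; congr EFin.
  under eq_bigr do rewrite mxE mulrDr.
  by rewrite big_split /= -mulr_suml w1 mul1r y_mean addr0.
split=> // [i|i j].
  by apply: integrable_sqr_Lfun2 => //; apply: (QI _ _).1; exact: measurable_funX.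
rewrite unlock !meanE /= unlock (QI _ _).2; last first.
  by apply: measurable_funM; apply: measurable_funB.
congr EFin; rewrite -y_cov; apply: eq_bigr => k _.
transitivity (w k * (((m + y k) i 0 - m i 0) * ((m + y k) j 0 - m j 0))) => //.
by rewrite !mxE; ring.
Qed.

End finite_support_moments.

Lemma psdmx_CauchySchwarz (R : realType) d (S : 'M[R]_d) (u x : 'cV[R]_d) :
  psdmx S -> dotv u (S *m x) ^+ 2 <= quadform S u * quadform S x.
Proof.
move=> /sqrtmxP []; set P := sqrtmx S => -[sP _] PP.
have e a b : dotv a (S *m b) = dotv (P *m a) (P *m b).
  by rewrite dotv_mulmx sP mulmxA PP.
by rewrite /quadform !e; exact: dotv_CauchySchwarz.
Qed.

(* theta = m + Z g + W with g = S x / sigma^2, where Z is a centered two-point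
   variable of variance sigma^2 and W is centered with covariance
   S - sigma^2 g g^T, hence orthogonal to x. *)
Lemma two_point_law (R : realType) d (m x : 'cV[R]_d) (S : 'M[R]_d) (r : R) :
  (0 < d)%N -> psdmx S -> 0 < quadform S x -> 0 < r ->
  dotv m x <= Num.sqrt (quadform S x) * r ->
  exists Q : vec_prob R d, has_mean_cov Q m S /\
    ((1 / (1 + r ^+ 2))%:E <= Q (unfavorable x))%E.
Proof.
move=> d0 pS q0 r0 mr; case: (pS) => sS _.
set s2 := quadform S x in q0 mr; pose s := Num.sqrt s2.
have s0 : 0 < s by rewrite sqrtr_gt0.
have ss : s ^+ 2 = s2 by rewrite sqr_sqrtr // ltW.
pose g := s2^-1 *: (S *m x).
have gx : dotv g x = 1.
  by rewrite /g dotvZl dotvC -[dotv x _]/s2 mulVf // gt_eqF.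
pose S' := S - s2 *: (g *m g^T).
have gg : s2 *: (g *m g^T) = s2^-1 *: ((S *m x) *m (S *m x)^T).
  rewrite /g linearZ /= -scalemxAl -scalemxAr !scalerA; congr (_ *: _).
  by field; rewrite gt_eqF.
have pS' : psdmx S'.
  split=> [|u]; first by rewrite /S' linearB linearZ /= trmx_mul trmxK sS.
  have := psdmx_CauchySchwarz u x pS.
  rewrite /quadform /S' gg; set v := S *m x => CS.
  rewrite mulmxBl -scalemxAl dotvBr dotvZr -mulmxA.
  rewrite [v^T *m u]mx11_scalar mul_mx_scalar dotvZr.
  rewrite -[(v^T *m u) 0 0]/(dotv v u) (dotvC v) subr_ge0.
  by rewrite ler_pdivrMl // mulrC -expr2 [leRHS]mulrC.
have [pP PP] := sqrtmxP pS'; set P := sqrtmx S' in pP PP; case: (pP) => sP _.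
have Px : P *m x = 0.
  apply/eqP; rewrite -dotv_eq0 dotv_mulmx sP mulmxA PP /S' mulmxBl -scalemxAl.
  have gx1 : g^T *m x = 1%:M by rewrite [LHS]mx11_scalar -[X in X%:M]/(dotv g x) gx.
  rewrite dotvBr dotvZr -mulmxA gx1 mulmx1 (dotvC x g) gx mulr1.
  by rewrite -[dotv x _]/s2 subrr.
(* These values and the weights [q] give mean 0 and variance [s ^+ 2]. The value [- (s * r)] is what
   brings [dotv m x] down to at most 0, by the hypothesis on [r]. *)
pose z (b : bool) := if b then - (s * r) else s / r.
pose q (b : bool) := (if b then 1 else r ^+ 2) / (1 + r ^+ 2).
(* An outcome picks a value of [Z], a column of [P] and a sign. Uniform signed columns scaled by the
   square root of [d] have covariance [P P^T = S']. *)
pose I := (bool * 'I_d * bool)%type.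
pose dR := (d%:R : R).
have dR0 : 0 < dR by rewrite ltr0n.
pose w (i : I) := q i.1.1 / (dR * 2).
pose y (i : I) : 'cV[R]_d :=
  z i.1.1 *: g + ((-1) ^+ i.2 * Num.sqrt dR) *: col i.1.2 P.
have r2 : 0 < 1 + r ^+ 2 by rewrite ltr_pwDl // sqr_ge0.
have wgt0 i : 0 < w i.
  apply: divr_gt0; last exact: mulr_gt0.
  by apply: divr_gt0 => //; case: i.1.1 => //; exact: exprn_gt0.
have w0 i : 0 <= w i by exact: ltW.
have sumI (F : bool -> 'I_d -> bool -> R) : \sum_(i : I) F i.1.1 i.1.2 i.2 =
    \sum_b \sum_i (F b i true + F b i false).
  rewrite -(pair_bigA _ (fun (bi : bool * 'I_d) c => F bi.1 bi.2 c)) /=.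
  rewrite -(pair_bigA _ (fun b i => \sum_c F b i c)) /=.
  by apply: eq_bigr => b _; apply: eq_bigr => i _; rewrite big_bool.
have sumd (c : R) : \sum_(i < d) c = dR * c by rewrite sumr_const card_ord mulr_natl.
have w1 : \sum_i w i = 1.
  rewrite (sumI (fun b _ _ => q b / (dR * 2))).
  under eq_bigr do rewrite sumd.
  by rewrite big_bool /= /q; field; rewrite !gt_eqF.
have yE (i : I) j : y i j 0 = z i.1.1 * g j 0 + (-1) ^+ i.2 * Num.sqrt dR * P j i.1.2.
  by rewrite !mxE.
have y_mean j : \sum_i w i * y i j 0 = 0.
  under eq_bigr do rewrite yE.
  rewrite (sumI (fun b i c => q b / (dR * 2) *
      (z b * g j 0 + (-1) ^+ c * Num.sqrt dR * P j i))).
  under eq_bigr => b _.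
    under eq_bigr => i _.
      rewrite (_ : _ + _ = q b / dR * (z b * g j 0)); last first.
        by rewrite expr1 expr0; field; rewrite !gt_eqF.
      over.
    rewrite sumd; over.
  by rewrite big_bool /= /q /z; field; rewrite !gt_eqF.
have y_cov j k : \sum_i w i * (y i j 0 * y i k 0) = S j k.
  under eq_bigr do rewrite !yE.
  rewrite (sumI (fun b i c => q b / (dR * 2) *
      ((z b * g j 0 + (-1) ^+ c * Num.sqrt dR * P j i) *
       (z b * g k 0 + (-1) ^+ c * Num.sqrt dR * P k i)))).
  have dd : Num.sqrt dR ^+ 2 = dR by rewrite sqr_sqrtr // ltW.
  under eq_bigr => b _.
    under eq_bigr => i _.
      rewrite (_ : _ + _ = q b / dR * (z b ^+ 2 * (g j 0 * g k 0)) +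
                 q b * (P j i * P i k)); last first.
        have -> : P i k = P k i by rewrite -{1}sP mxE.
        move: dd; have : 0 < Num.sqrt dR by rewrite sqrtr_gt0.
        move: (Num.sqrt dR) => e e0 <-; rewrite expr1 expr0.
        by field; rewrite gt_eqF.
      over.
    rewrite big_split /= sumd -mulr_sumr -[\sum_i _]/(\sum_i P j i * P i k).
    rewrite (_ : \sum_i _ = S' j k); last by rewrite -PP mxE.
    over.
  rewrite big_bool /= /S' !mxE big_ord1 !mxE -ss /q /z.
  by field; rewrite !gt_eqF.
have [Q [Qm QE]] := finite_support_law m w0 w1 y_mean y_cov.
exists Q; split=> //; rewrite QE.
have -> : 1 / (1 + r ^+ 2) = \sum_(i : I) w i * i.1.1%:R.
  rewrite (sumI (fun b _ _ => q b / (dR * 2) * b%:R)).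
  under eq_bigr do rewrite sumd.
  by rewrite big_bool /= /q; field; rewrite !gt_eqF.
rewrite -sumEFin; apply: lee_sum => i _; rewrite EFinM lee_pmul2l ?lte_fin //.
rewrite diracE lee_fin ler_nat.
case: i => -[[] i] c //=; rewrite mem_set //= /unfavorable /=.
rewrite dotvDl /y /= dotvDl dotvZl gx dotvZl.
have -> : dotv (col i P) x = 0.
  by rewrite colE dotv_mulmx sP Px dotvE big1 // => j _; rewrite [X in _ * X]mxE mulr0.
by rewrite mulr0 addr0 mulr1 subr_le0.
Qed.

(** * The worst-case probability over a Gelbrich ball *)

(** The covariance is taken against an arbitrary [Y] so that two uses, one per argument, expand the
    variance of [Z] into a quadratic form. *)
Lemma linear_combination_moments (dT : measure_display) (T : measurableType dT)
    (R : realType) (P : probability T R) (I : Type) (s : seq I) (a : I -> R)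
    (X : I -> T -> R) :
  (forall i, X i \in Lfun P 2%:E) ->
  let Z := fun t => \sum_(i <- s) a i * X i t in
  [/\ Z \in Lfun P 2%:E,
      ('E_P[Z] = \sum_(i <- s) (a i)%:E * 'E_P[X i])%E &
      forall Y, Y \in Lfun P 2%:E ->
        (covariance P Z Y = \sum_(i <- s) (a i)%:E * covariance P (X i) Y)%E].
Proof.
move=> X2; have Pfin : P setT \is a fin_num := fin_num_measure P _ measurableT.
have X1 i := Lfun_subset12 Pfin (X2 i).
elim: s => [|i s [Z2 EZ covZ]] Z.
  have Z0 : Z = cst 0 by apply/funext => t; rewrite /Z big_nil.
  rewrite Z0; split; first exact: Lfun_cst.
    by rewrite expectation_cst big_nil.
  by move=> Y _; rewrite covariance_cst_l big_nil.
have ZE : Z = (a i \o* X i) \+ (fun t => \sum_(i <- s) a i * X i t).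
  by apply/funext => t; rewrite /Z big_cons /= mulrC.
have aX2 : a i \o* X i \in Lfun P 2%:E by apply: Lfun_scale => //; rewrite ler1n.
rewrite ZE; split.
- by rewrite rpredD ?lee1n //= => _.
- by rewrite expectationD ?(Lfun_subset12 Pfin) // expectationZl // EZ big_cons.
- move=> Y Y2; rewrite covarianceDl // covZ // big_cons covarianceZl //.
    exact: Lfun_subset12.
  exact: Lfun2_mul_Lfun1.
Qed.

Lemma cantelli_unfavorable (R : realType) d (Q : vec_prob R d) (m x : 'cV[R]_d)
    (S : 'M[R]_d) :
  has_mean_cov Q m S -> 0 < dotv m x ->
  (Q (unfavorable x) <= (quadform S x / (quadform S x + dotv m x ^+ 2))%:E)%E.
Proof.
(* Cantelli's inequality bounds an upper tail, hence the sign: a deviation of [- theta . x] by at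
   least [dotv m x] above its mean is exactly [theta . x <= 0]. *)
move=> [c2 cE cC] mx0; pose a i := - x i 0.
have [Z2 EZ covZ] := linear_combination_moments (index_enum 'I_d) a c2.
set Z := (fun t => _) in Z2 EZ covZ.
have ZE t : Z t = - dotv (t : 'cV[R]_d) x.
  by rewrite dotvE -sumrN; apply: eq_bigr => i _; rewrite /a mulNr mulrC.
have EZ' : 'E_Q[Z]%E = (- dotv m x)%:E.
  rewrite EZ dotvE -sumrN -sumEFin; apply: eq_bigr => i _.
  by rewrite cE -EFinM /a mulNr mulrC.
have VZ : ('V_Q[Z] = (quadform S x)%:E)%E.
  rewrite /variance covZ // /quadform dotvE -sumEFin; apply: eq_bigr => i _.
  rewrite covarianceC covZ // mxE mulr_sumr.
  rewrite (_ : (\sum_j _ = (- (\sum_j S i j * x j 0))%:E)%E).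
    by rewrite -EFinM /a mulrNN mulr_sumr.
  rewrite -sumrN -sumEFin; apply: eq_bigr => j _.
  by rewrite covarianceC cC -EFinM /a mulNr mulrC.
have mZ : measurable_fun setT Z.
  by move: Z2; rewrite inE => /andP[/set_mem].
pose X := mfun_Sub (mem_set mZ).
have := @cantelli _ _ _ Q X (dotv m x) Z2 mx0.
rewrite VZ EZ' /=; congr (Q _ <= _)%E.
by apply/seteqP; split=> t; rewrite /unfavorable /= ZE -EFinB lee_fin => h; lra.
Qed.

Lemma ler_sqr_le (R : realDomainType) (a b : R) : 0 <= b -> a ^+ 2 <= b ^+ 2 -> - b <= a <= b.
Proof.
by move=> b0 ab; rewrite -ler_norml -ler_sqr ?nnegrE ?normr_ge0 // real_normK ?num_real.
Qed.

(* The disc of center (- A, B) and radius C lies below its tangent line through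
   the origin, whose angle with the first axis has sine s and cosine c. *)
Section tangent_line.
Variables (R : realType) (A B C : R).
Hypotheses (B0 : 0 < B) (C0 : 0 <= C) (AC : A + C < 0).
Let A0 : 0 < - A.
Proof. by move: C0 AC; lra. Qed.

Let A2C2 : 0 < A ^+ 2 - C ^+ 2.
Proof. by rewrite subr_sqr -mulrNN; apply: mulr_gt0; move: C0 AC; lra. Qed.

Let N := A ^+ 2 + B ^+ 2.
Let D := Num.sqrt (A ^+ 2 + B ^+ 2 - C ^+ 2).
(** Angle addition: the center has polar angle with cosine [- A / sqrt N] and sine [B / sqrt N], the
    tangent makes with it an angle of sine [C / sqrt N] and cosine [D / sqrt N], and [s], [c] are
    the sine and cosine of the sum. *)
Let s := (- A * C + B * D) / N.
Let c := (- A * D - B * C) / N.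

Let N0 : 0 < N.
Proof. by rewrite ltr_wpDl ?sqr_ge0 // exprn_gt0. Qed.

Let D2 : D ^+ 2 = N - C ^+ 2.
Proof.
rewrite sqr_sqrtr // addrAC addr_ge0 ?sqr_ge0 //; exact: ltW.
Qed.

Let D0 : 0 < D.
Proof.
by rewrite sqrtr_gt0 addrAC addr_gt0 // exprn_gt0.
Qed.

Lemma tangent_sin_gt0 : 0 < s.
Proof.
by rewrite divr_gt0 // ltr_wpDl ?mulr_gt0 // mulr_ge0 // ltW.
Qed.

(** The difference of the squares of [- A * D] and [B * C] factors as [N * (A ^+ 2 - C ^+ 2)],
    positive because the disc stays at positive abscissae. *)
Lemma tangent_cos_gt0 : 0 < c.
Proof.
rewrite divr_gt0 // subr_gt0.
have : (B * C) ^+ 2 < (- A * D) ^+ 2.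
  rewrite !exprMn D2 -subr_gt0.
  rewrite (_ : _ - _ = N * (A ^+ 2 - C ^+ 2)); last by rewrite /N; ring.
  exact: mulr_gt0.
by rewrite ltr_sqr // nnegrE mulr_ge0 // ltW.
Qed.

Lemma tangent_sin2cos2 : s ^+ 2 + c ^+ 2 = 1.
Proof.
have -> : s ^+ 2 + c ^+ 2 = (C ^+ 2 + D ^+ 2) / N.
  rewrite /s /c /N; field; exact: lt0r_neq0.
by rewrite D2 addrC subrK divff // gt_eqF.
Qed.

(** Tangency: the left-hand side is the distance from the center to the line of direction [(c, s)],
    measured along the unit normal [(s, - c)]. *)
Lemma tangent_dist : - A * s - B * c = C.
Proof. rewrite /s /c /N; field; exact: lt0r_neq0. Qed.

(** A point of the disc moves by at most [C] along the normal [(s, - c)], and the center lies at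
    distance exactly [C] from the line; so [sigma * c <= mu * s], and squaring gives the ratio. *)
Lemma tangent_ratio_le mu sigma :
  0 <= sigma -> (mu + A) ^+ 2 + (sigma - B) ^+ 2 <= C ^+ 2 ->
  0 < mu /\ sigma ^+ 2 / (sigma ^+ 2 + mu ^+ 2) <= s ^+ 2.
Proof.
move=> sg0 disc.
have /andP[muA _] : - C <= mu + A <= C.
  apply: ler_sqr_le => //; apply: le_trans disc; by rewrite lerDl sqr_ge0.
have mu0 : 0 < mu by move: AC; lra.
split=> //.
have /andP[tan _] : - C <= (mu + A) * s - (sigma - B) * c <= C.
  apply: ler_sqr_le => //; apply: le_trans disc.
  rewrite -[leRHS]mulr1 -tangent_sin2cos2 -subr_ge0.
  rewrite (_ : _ - _ = ((mu + A) * c + (sigma - B) * s) ^+ 2) ?sqr_ge0 //; ring.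
have le1 : sigma * c <= mu * s.
  by have := tangent_dist; move: tan; lra.
have c0 := tangent_cos_gt0; have s0 := tangent_sin_gt0.
have le2 : (sigma * c) ^+ 2 <= (mu * s) ^+ 2.
  by rewrite ler_sqr // nnegrE mulr_ge0 // ltW.
rewrite ler_pdivrMr; last by rewrite ltr_wpDl ?sqr_ge0 // exprn_gt0.
have : sigma ^+ 2 * s ^+ 2 + sigma ^+ 2 * c ^+ 2 = sigma ^+ 2.
  by rewrite -mulrDr tangent_sin2cos2 mulr1.
by move: le2; rewrite !exprMn; lra.
Qed.

End tangent_line.

Section worst_case_probability.
Variables (R : realType) (d : nat).
Hypothesis d0 : (0 < d)%N.
Variables (mhat : 'cV[R]_d) (Shat : 'M[R]_d) (rho : R).
Hypotheses (pSh : posdefmx Shat) (rho0 : 0 <= rho).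
Let ball := gelbrich_ball mhat Shat rho.

Lemma worst_prob_le1 (D : set (vec_prob R d)) x : (worst_prob D x <= 1)%E.
Proof.
by apply: ge_ereal_sup => _ [Q _ <-]; apply: probability_le1; exact: measurable_unfavorable.
Qed.

(** Source of all lower bounds: [a] moves the mean along [x], [b] stretches the deviation along [x],
    and [r] bounds the ratio of mean to deviation, so that [1 / (1 + r ^+ 2)] is a squared sine. *)
Lemma gelbrich_ball_shift x a b (r : R) : x != 0 -> 0 <= b -> 0 < r ->
  dotv x x * (a ^+ 2 + b ^+ 2 * quadform Shat x) <= rho ^+ 2 ->
  dotv mhat x + a * dotv x x <= (1 + b * dotv x x) * Num.sqrt (quadform Shat x) * r ->
  exists2 Q, ball Q & ((1 / (1 + r ^+ 2))%:E <= Q (unfavorable x))%E.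
Proof.
move=> x0 b0 r0 le_rho le_r.
have [S [pS Sx SG]] := gelbrich_shift mhat a x pSh b0.
have xx := dotv_gt0 x0; have qx := pSh.2 _ x0.
have b1 : 0 < 1 + b * dotv x x by rewrite ltr_pwDl // mulr_ge0 // ltW.
have [|||Q [Qm Qu]] := @two_point_law R d (mhat + a *: x) x S r d0 pS.
- by rewrite Sx mulr_gt0 ?exprn_gt0.
- by [].
- by rewrite Sx sqrtrM ?sqr_ge0 // sqrtr_sqr gtr0_norm // dotvDl dotvZl.
exists Q => //; exists (mhat + a *: x), S; split=> //.
by rewrite SG -(ger0_norm rho0) -sqrtr_sqr ler_sqrt // sqr_ge0.
Qed.

(** Serves the point [x = 0], where the event is the whole space but a supremum over an empty ball
    would be -oo. *)
Lemma gelbrich_ball_nonempty : exists Q, ball Q.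
Proof.
pose x : 'cV[R]_d := const_mx 1.
have x0 : x != 0.
  by apply/eqP => /matrixP/(_ (Ordinal d0) 0)/eqP; rewrite !mxE oner_eq0.
have B0 : 0 < Num.sqrt (quadform Shat x) by rewrite sqrtr_gt0 pSh.2.
pose r := `|dotv mhat x| / Num.sqrt (quadform Shat x) + 1.
have [|||Q QB _] := @gelbrich_ball_shift x 0 0 r x0 (lexx 0); last by exists Q.
- by rewrite /r ltr_wpDl // divr_ge0 // ltW.
- by rewrite expr0n mul0r addr0 mulr0 sqr_ge0.
- rewrite !mul0r !addr0 mul1r /r mulrDr mulr1 mulrCA divff ?gt_eqF // mulr1.
  by rewrite (le_trans (ler_norm _)) // lerDl ltW.
Qed.

Lemma worst_prob_degenerate x : 0 <= - dotv mhat x + rho * norm2 x ->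
  worst_prob ball x = 1%E.
Proof.
move=> AC; apply/eqP; rewrite eq_le worst_prob_le1 /=.
have [x0|x0] := eqVneq x 0.
  have [Q QB] := gelbrich_ball_nonempty.
  apply: ereal_sup_ubound; exists Q => //.
  rewrite (_ : unfavorable x = setT) ?probability_setT //.
  apply/seteqP; split=> // t _; rewrite /unfavorable /= x0 dotvE big1 //.
  by move=> i _; rewrite mxE mulr0.
apply/lee_addgt0Pr => e e0.
have nx := norm2_gt0 x0.
(* Spending the whole radius on the mean brings it to at most 0 along [x]. Any [r > 0] is then
   admissible, and the square root of [e] leaves mass [1 / (1 + e) >= 1 - e]. *)
have [|||Q QB Qu] := @gelbrich_ball_shift x (- (rho / norm2 x)) 0 (Num.sqrt e) x0 (lexx 0).
- by rewrite sqrtr_gt0.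
- by rewrite expr0n mul0r addr0 -sqr_norm2 sqrrN -exprMn mulrC divfK ?gt_eqF.
- rewrite mul0r addr0 mul1r; apply: (@le_trans _ _ 0); last by rewrite mulr_ge0 ?sqrtr_ge0.
  by rewrite -sqr_norm2 expr2 mulrA mulNr divfK ?gt_eqF // mulNr; lra.
apply: (@le_trans _ _ (Q (unfavorable x) + e%:E)%E); last first.
  by rewrite leeD2r //; apply: ereal_sup_ubound; exists Q.
apply: le_trans (leeD2r e%:E Qu).
rewrite -EFinD lee_fin sqr_sqrtr ?(ltW e0) // -lerBlDr ler_pdivlMr; nra.
Qed.

Lemma worst_prob_regular x :
  let A := - dotv mhat x in
  let B := Num.sqrt (quadform Shat x) in
  let C := rho * norm2 x in
  let v := ((- A * C + B * Num.sqrt (A ^+ 2 + B ^+ 2 - C ^+ 2)) /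
            (A ^+ 2 + B ^+ 2)) ^+ 2 in
  A + C < 0 -> worst_prob ball x = v%:E /\ 0 < v < 1.
Proof.
move=> A B C; set s := (X in X ^+ 2) => v AC.
have x0 : x != 0.
  apply/eqP => x0; move: AC; rewrite /A /C x0 /norm2.
  have dotv0 u : dotv u (0 : 'cV[R]_d) = 0 by rewrite dotvE big1 // => i _; rewrite mxE mulr0.
  by rewrite !dotv0 sqrtr0 mulr0 oppr0 addr0 ltxx.
have nx := norm2_gt0 x0.
have qx : 0 < quadform Shat x by exact: pSh.2.
have B0 : 0 < B by rewrite sqrtr_gt0.
have B2 : B ^+ 2 = quadform Shat x by rewrite sqr_sqrtr // ltW.
have C0 : 0 <= C by rewrite mulr_ge0 // ltW.
have s0 : 0 < s := tangent_sin_gt0 B0 C0 AC.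
have c0 := tangent_cos_gt0 B0 C0 AC.
have sc := tangent_sin2cos2 B0 C0 AC.
have tan := tangent_dist A C B0.
set c := (- A * _ - B * C) / _ in c0 sc tan.
rewrite -/s in sc tan.
have v1 : 0 < v < 1.
  by rewrite exprn_gt0 //= -sc ltrDl exprn_gt0.
split=> //; apply/eqP; rewrite eq_le; apply/andP; split.
  apply: ge_ereal_sup => _ [Q [m [S [pS Qm SG]]] <-].
  have := gelbrich_proj m mhat x pS pSh.
  set mu := dotv m x; set sigma := Num.sqrt (quadform S x) => le_disc.
  have sg2 : sigma ^+ 2 = quadform S x by rewrite sqr_sqrtr //; case: pS.
  have [|mu0 le_s] := tangent_ratio_le B0 C0 AC (sqrtr_ge0 (quadform S x)) (mu := mu).
    apply: le_trans le_disc _; rewrite ler_sqr ?nnegrE //.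
      by rewrite ler_wpM2r // ltW.
    by rewrite mulr_ge0 ?sqrtr_ge0 // ltW.
  apply: le_trans (cantelli_unfavorable Qm mu0) _.
  by rewrite lee_fin -sg2.
(* These parameters reach the contact point, of mean [- A - C * s] and deviation [B + C * c]; the
   ratio of the two is the cotangent [c / s]. *)
have [||||Q QB Qu] := @gelbrich_ball_shift x (- (rho * s / norm2 x))
    (rho * c / (norm2 x * B)) (c / s) x0.
- by apply: divr_ge0; apply: mulr_ge0 => //; exact: ltW.
- by rewrite divr_gt0.
- rewrite -B2 -sqr_norm2 -[leRHS]mulr1 -sc le_eqVlt; apply/orP; left; apply/eqP.
  by field; rewrite !gt_eqF.
- rewrite -/B -sqr_norm2 le_eqVlt; apply/orP; left; apply/eqP.
  rewrite (_ : dotv mhat x = - A); last by rewrite opprK.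
  have -> : - A + - (rho * s / norm2 x) * norm2 x ^+ 2 = - A - C * s.
    by rewrite /C; field; rewrite gt_eqF.
  have -> : (1 + rho * c / (norm2 x * B) * norm2 x ^+ 2) * B * (c / s) = (B + C * c) * c / s.
    by rewrite /C; field; rewrite !gt_eqF.
  apply: (canRL (mulfK (lt0r_neq0 s0))).
  have : C * (s ^+ 2 + c ^+ 2) = - A * s - B * c by rewrite sc tan mulr1.
  by clear; lra.
apply: (@le_trans _ _ (Q (unfavorable x))); last by apply: ereal_sup_ubound; exists Q.
apply: le_trans Qu; rewrite lee_fin le_eqVlt; apply/orP; left; apply/eqP.
have -> : 1 + (c / s) ^+ 2 = (s ^+ 2 + c ^+ 2) / s ^+ 2.
  by field; rewrite gt_eqF.
by rewrite sc !div1r invrK.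
Qed.

End worst_case_probability.

(** * Duality for the mixture weights *)

(** A cluster point of the tail filter in the compact cube suffices: one index is both large and
    close to [P], so no subsequence is extracted. *)
Lemma rV_bounded_cluster (R : realType) K (p : nat -> 'I_K -> R) :
  (forall n k, 0 <= p n k <= 1) ->
  exists P, forall e, 0 < e ->
    exists n, n.+1%:R^-1 <= e /\ forall k, `|p n k - P k| <= e.
Proof.
move=> p01; case: K => [|K] in p p01 *.
  exists (fun=> 0) => e e0; exists (Num.truncn e^-1); split=> [|[]//].
  by rewrite invf_ple ?posrE // ltW // truncnS_gt.
pose F : set_system 'rV[R]_K.+1 := (fun n => \row_k p n k) @ \oo.
have cA := @rV_compact R _ (fun=> `[0, 1]%classic) (fun=> @segment_compact R 0 1).
have FA : F [set v : 'rV[R]_K.+1 | forall i, `[0, 1]%classic (v ord0 i)].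
  by exists 0%N => // n _ i; rewrite /= in_itv /= mxE.
have [P [_ clP]] := cA _ F _ FA.
exists (fun k => P 0 k) => e e0.
have FN : F [set v | exists2 n, n.+1%:R^-1 <= e & v = \row_k p n k].
  exists (Num.truncn e^-1) => // n /= le_n; exists n => //.
  rewrite invf_ple ?posrE // ltW // (lt_le_trans (truncnS_gt _)) //.
  by rewrite ler_nat ltnS.
have [v [[n ne ->] [_ Pv]]] := clP _ _ FN (nbhsx_ballx P e e0).
exists n; split=> // k; have := Pv 0 k.
by rewrite /ball /= mxE distrC => /ltW.
Qed.

(* Here a stands for the violation of a constraint and y for the value reached. *)
Lemma multiplier_exists (R : realType) (W : set (R * R)) (j : R) :
  (forall a y b z, W (a, y) -> W (b, z) -> 0 < a -> b < 0 ->
     a * z - b * y <= j * (a - b)) ->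
  (exists a y, W (a, y) /\ 0 < a) -> (exists b z, W (b, z) /\ b < 0) ->
  (forall y, W (0, y) -> y <= j) ->
  exists lam, forall a y, W (a, y) -> y - lam * a <= j.
Proof.
move=> Wconv [a0 [y0 [W0 a00]]] [b0 [z0 [Wb b00]]] Wz.
(* Points with [a > 0] demand [lam >= (y - j) / a], points with [a < 0] demand
   [lam <= (j - y) / - a]. [X] collects the lower demands, and [Wconv] places each of them below
   every upper one. *)
pose X := [set (q.2 - j) / q.1 | q in [set q | W q /\ 0 < q.1]].
have ubX b z : W (b, z) -> b < 0 -> ubound X ((j - z) / - b).
  move=> Wbz b_lt0 _ [[a y] [/= Way a_gt0] <-].
  have b_gt0 : 0 < - b by rewrite oppr_gt0.
  rewrite ler_pdivrMr // mulrAC ler_pdivlMr //.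
  by have := Wconv _ _ _ _ Way Wbz a_gt0 b_lt0; lra.
have X0 : X !=set0 by exists ((y0 - j) / a0); exists (a0, y0).
have hX : has_sup X by split=> //; exists ((j - z0) / - b0); exact: ubX.
exists (sup X) => a y Way.
have [a_lt0|a_gt0|a_eq0] := ltgtP a 0.
- have : sup X <= (j - y) / - a by apply: ge_sup => //; exact: ubX.
  by rewrite ler_pdivlMr ?oppr_gt0 //; lra.
- have : (y - j) / a <= sup X by apply: ub_le_sup; [case: hX|exists (a, y)].
  by rewrite ler_pdivrMr //; lra.
- by rewrite a_eq0 mulr0 subr0; apply: Wz; rewrite -a_eq0.
Qed.

(** * The perspective of [phi], including nominal weight 0 *)

Lemma convex_function_geP (R : realType) (phi : R -> R) :
  convex_function (`[0, +oo[%classic : set R) phi ->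
  forall a b t, 0 <= a -> 0 <= b -> 0 <= t <= 1 ->
  phi (t * a + (1 - t) * b) <= t * phi a + (1 - t) * phi b.
Proof.
move=> cphi a b t a0 b0 /andP[t0 t1].
have aD : a \in (`[0, +oo[%classic : set R) by rewrite inE /= in_itv /= a0.
have bD : b \in (`[0, +oo[%classic : set R) by rewrite inE /= in_itv /= b0.
by have := cphi (Itv01 t0 t1) a b aD bD; rewrite !convRE.
Qed.

Section perspective.
Variables (R : realType) (phi : R -> R).
Hypothesis cphi : convex_function (`[0, +oo[%classic : set R) phi.
Hypothesis phi1 : phi 1 = 0.

Let phi_conv := convex_function_geP cphi.

(** Since 2 is a convex combination of [t] and 1, and [phi 1 = 0], convexity gives
    [(t - 1) * phi 2 <= phi t]. This keeps [phi t / t] bounded below. *)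
Lemma phi_linear_minorant t : 2 <= t -> - (t * `|phi 2|) <= phi t.
Proof.
move=> t2; have t1 : 0 < t - 1 by lra.
have w01 : 0 <= (t - 1)^-1 <= 1.
  by rewrite invr_ge0 (ltW t1) invf_le1 //; lra.
have := @phi_conv t 1 (t - 1)^-1 (le_trans (ler0n _ 2) t2) ler01 w01.
rewrite phi1 mulr0 addr0 (_ : _ * t + _ = 2); last by field; rewrite gt_eqF.
rewrite mulrC ler_pdivlMr // => phi2.
have := ler_norm (- phi 2); rewrite normrN; have := normr_ge0 (phi 2).
by nra.
Qed.

Lemma phi_slope_neqNy : phi_slope phi != -oo%E.
Proof.
rewrite /phi_slope; set F := (X in lim X).
(* If the limit failed to exist, [lim] would be the default point of the extended reals, which is
   not -oo; existence need not be settled here. *)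
have [cF|ncF] := pselect (cvg F); last first.
  by rewrite (dvgP ncF).
suff : ((- `|phi 2|)%:E <= lim F)%E by case: (lim F).
apply: lime_ge => //; exists 2; split=> // t t2.
have t0 : 0 < t by rewrite (lt_trans _ t2).
by rewrite lee_fin ler_pdivlMr // mulNr mulrC phi_linear_minorant // ltW.
Qed.

(** Properties of one summand of the divergence when it is finite on the whole half-line. The
    subgradient is guarded by [0 < q -> 0 < p]: for [q > 0] the function may jump or have infinite
    slope at 0, while for [q = 0] it is linear. *)
Definition real_persp (h : R -> R) (q : R) : Prop :=
  [/\ forall p, 0 <= p -> phi_persp phi q p = (h p)%:E,
      forall a b t, 0 <= a -> 0 <= b -> 0 <= t <= 1 ->
        h (t * a + (1 - t) * b) <= t * h a + (1 - t) * h b,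
      forall p, 0 <= p -> (0 < q -> 0 < p) ->
        exists s, forall y, 0 <= y -> h p + s * (y - p) <= h y &
      forall t, 0 <= t -> h (q * t) = q * phi t].

(** The second case is nominal weight 0 with infinite slope, where a finite divergence forces the
    weight to vanish. *)
Lemma phi_persp_dichotomy q : 0 <= q ->
  (exists h, real_persp h q) \/
  (q = 0 /\ forall p, 0 <= p -> (phi_persp phi q p < +oo)%E -> p = 0).
Proof.
move=> q0; have [->|qn0] := eqVneq q 0; last first.
  have qgt0 : 0 < q by rewrite lt0r qn0.
  have hconv a b t : 0 <= a -> 0 <= b -> 0 <= t <= 1 ->
      q * phi ((t * a + (1 - t) * b) / q) <=
      t * (q * phi (a / q)) + (1 - t) * (q * phi (b / q)).
    move=> a0 b0 t01; rewrite mulrCA (mulrCA (1 - t)) -mulrDr ler_pM2l //.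
    by rewrite mulrDl -!mulrA; apply: phi_conv => //; rewrite divr_ge0.
  left; exists (fun p => q * phi (p / q)); split=> //.
  - by move=> p p0; rewrite /phi_persp (negbTE qn0).
  - move=> p p0 /(_ qgt0) pgt0; set h := fun p => q * phi (p / q).
    (* A subgradient is minus the multiplier of the constraint [y = p]. Points on both sides are
       required: [p + 1] on the right, and 0 on the left because [p > 0]. *)
    have [||||lam lamP] := @multiplier_exists R
        [set z | exists2 y, 0 <= y & z = (y - p, - h y)] (- h p).
    - move=> _ _ _ _ [y y0 [-> ->]] [z z0 [-> ->]] yp zp.
      have yz : 0 < y - z by lra.
      have t01 : 0 <= (p - z) / (y - z) <= 1.
        by rewrite divr_ge0 ?ler_pdivrMr //=; lra.
      have := hconv y z _ y0 z0 t01; rewrite -!/(h _).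
      rewrite (_ : _ * y + _ = p); last by field; rewrite gt_eqF.
      rewrite (_ : _ + _ = ((p - z) * h y + (y - p) * h z) / (y - z)); last first.
        by field; rewrite gt_eqF.
      by rewrite ler_pdivlMr //; lra.
    - by exists 1, (- h (p + 1)); split; [exists (p + 1); [lra|congr pair; lra]|].
    - exists (- p), (- h 0); split; last by rewrite oppr_lt0.
      by exists 0; [|congr pair; rewrite sub0r].
    - by move=> y1 [y y0 [/esym/eqP]]; rewrite subr_eq0 => /eqP -> ->.
    - exists (- lam) => y y0; rewrite -/(h p) -/(h y).
      by have := lamP (y - p) (- h y) (ex_intro2 _ _ y y0 erefl); lra.
  - by move=> t t0; rewrite mulrAC divff // mul1r.
have := phi_slope_neqNy; case E : (phi_slope phi) => [s| |] // _.
- left; exists (fun p => p * s); split=> //.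
  + move=> p p0; rewrite /phi_persp eqxx E; case: eqP => [->|//]; by rewrite mul0r.
  + by move=> *; lra.
  + by move=> p p0 _; exists s => y y0; lra.
  + by move=> t t0; rewrite !mul0r.
- right; split=> // p p0; rewrite /phi_persp eqxx E; case: eqP => // /eqP pn0.
  by rewrite gt0_muley ?lte_fin ?lt0r ?pn0.
Qed.

End perspective.

Lemma ler_addgt0_scale (R : realFieldType) (a b c : R) : 0 <= c ->
  (forall e, 0 < e -> a <= b + c * e) -> a <= b.
Proof.
move=> c0 H; apply/ler_addgt0Pr => e e0.
have c1 : 0 < c + 1 by rewrite ltr_wpDl.
apply: le_trans (H (e / (c + 1)) (divr_gt0 e0 c1)) _.
by rewrite lerD2l mulrCA ler_piMr ?(ltW e0) // ler_pdivrMr // mul1r lerDl.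
Qed.

Section weight_duality.
Variables (R : realType) (K : nat) (phi : R -> R) (phat f : 'I_K -> R).
Hypothesis cphi : convex_function (`[0, +oo[%classic : set R) phi.
Hypothesis phi1 : phi 1 = 0.
Hypothesis phat0 : forall k, 0 <= phat k.
Hypothesis phat1 : \sum_k phat k = 1.

Let phi_conv := convex_function_geP cphi.
Let dichotomy k := phi_persp_dichotomy cphi phi1 (phat0 k).

Definition persp_dom k (p : R) : Prop := 0 <= p /\ (phi_persp phi (phat k) p < +oo)%E.
(** Meaningful on [persp_dom] only; elsewhere [fine] may turn +oo into 0. *)
Definition persp k (p : R) : R := fine (phi_persp phi (phat k) p).

Lemma perspE k p : persp_dom k p -> phi_persp phi (phat k) p = (persp k p)%:E.
Proof.
case=> p0 ploty; rewrite /persp; have [[h [hE _ _ _]]|[q0 p_eq0]] := dichotomy k.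
  by rewrite hE.
by rewrite (p_eq0 _ p0 ploty) q0 /phi_persp !eqxx.
Qed.

Lemma phi_persp_neqNy k p : 0 <= p -> phi_persp phi (phat k) p != -oo%E.
Proof.
move=> p0; apply/eqP => pE; have : persp_dom k p by split; rewrite // pE.
by move/perspE; rewrite pE.
Qed.

Lemma persp_convex k a b t : persp_dom k a -> persp_dom k b -> 0 <= t <= 1 ->
  persp_dom k (t * a + (1 - t) * b) /\
  persp k (t * a + (1 - t) * b) <= t * persp k a + (1 - t) * persp k b.
Proof.
move=> [a0 aoo] [b0 boo] t01; rewrite /persp_dom /persp; case/andP: (t01) => t0 t1.
have ab0 : 0 <= t * a + (1 - t) * b by rewrite addr_ge0 ?mulr_ge0 // subr_ge0.
have [[h [hE hconv _ _]]|[q0 p_eq0]] := dichotomy k.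
  by rewrite !hE ?ltry //=; split=> //; exact: hconv.
have za := p_eq0 _ a0 aoo; have zb := p_eq0 _ b0 boo; rewrite za in aoo *.
by rewrite zb !mulr0 addr0 -mulrDl addrC subrK mul1r.
Qed.

Lemma persp_subgradient k p : persp_dom k p -> (0 < phat k -> 0 < p) ->
  exists s, forall y, persp_dom k y -> persp k p + s * (y - p) <= persp k y.
Proof.
move=> [p0 poo] pp; have [[h [hE _ hsub _]]|[q0 p_eq0]] := dichotomy k.
  have [s sP] := hsub _ p0 pp; exists s => y [y0 _].
  by rewrite /persp !hE //=; exact: sP.
exists 0 => y [y0 yoo]; rewrite mul0r addr0 (p_eq0 _ p0 poo) (p_eq0 _ y0 yoo).
exact: lexx.
Qed.

(** Along the ray through [phat] the perspective is [phi] itself, even at nominal weight 0 by the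
    convention [0 * phi (0 / 0) = 0]. This yields the Slater points and the change of variable in
    the conjugate. *)
Lemma persp_scale k t : 0 <= t ->
  persp_dom k (phat k * t) /\ persp k (phat k * t) = phat k * phi t.
Proof.
move=> t0; rewrite /persp_dom /persp.
have qt0 : 0 <= phat k * t by exact: mulr_ge0.
have [[h [hE _ _ hs]]|[q0 _]] := dichotomy k.
  by rewrite !hE ?ltry ?hs.
by rewrite q0 !mul0r /phi_persp !eqxx ltry.
Qed.

Definition weight_dom (p : 'I_K -> R) : Prop := forall k, persp_dom k (p k).
Definition divergence (p : 'I_K -> R) : R := \sum_k persp k (p k).
Definition payoff (p : 'I_K -> R) : R := \sum_k p k * f k.
Definition excess (p : 'I_K -> R) : R := \sum_k p k - 1.
Definition mix (t : R) (p q : 'I_K -> R) : 'I_K -> R :=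
  fun k => t * p k + (1 - t) * q k.

Lemma weight_dom_mix t p q : 0 <= t <= 1 -> weight_dom p -> weight_dom q ->
  weight_dom (mix t p q).
Proof. by move=> t01 Cp Cq k; apply: (persp_convex (Cp k) (Cq k) t01).1. Qed.

Lemma divergence_mix t p q : 0 <= t <= 1 -> weight_dom p -> weight_dom q ->
  divergence (mix t p q) <= t * divergence p + (1 - t) * divergence q.
Proof.
move=> t01 Cp Cq; rewrite /divergence !mulr_sumr -big_split /=.
by apply: ler_sum => k _; apply: (persp_convex (Cp k) (Cq k) t01).2.
Qed.

Lemma payoff_mix t p q : payoff (mix t p q) = t * payoff p + (1 - t) * payoff q.
Proof.
rewrite /payoff !mulr_sumr -big_split /=; apply: eq_bigr => k _.
by rewrite /mix; ring.
Qed.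

Lemma excess_mix t p q : excess (mix t p q) = t * excess p + (1 - t) * excess q.
Proof.
rewrite /excess (_ : \sum_k mix t p q k = t * \sum_k p k + (1 - t) * \sum_k q k).
  by ring.
by rewrite !mulr_sumr -big_split.
Qed.

Lemma phat_scale t : 0 <= t ->
  [/\ weight_dom (fun k => phat k * t), divergence (fun k => phat k * t) = phi t
    & excess (fun k => phat k * t) = t - 1].
Proof.
move=> t0; split.
- by move=> k; apply: (persp_scale k t0).1.
- rewrite /divergence; under eq_bigr do rewrite (persp_scale _ t0).2.
  by rewrite -mulr_suml phat1 mul1r.
- by rewrite /excess -mulr_suml phat1 mul1r.
Qed.

(** Convexity between 1 and 2, or 1 and 0, bounds [phi (1 + tau)] and [phi (1 - tau)] by [tau * M].
    Both signs are needed because the equality constraint must be violated in both directions. *)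
Lemma phat_scale_slater eps : 0 < eps -> exists2 tau, 0 < tau <= 1 &
  phi (1 + tau) <= eps /\ phi (1 - tau) <= eps.
Proof.
move=> eps0; pose M := `|phi 2| + `|phi 0| + 1.
have M0 : 0 < M by rewrite ltr_wpDl // addr_ge0.
pose tau := eps / (eps + M).
have eM : 0 < eps + M by rewrite addr_gt0.
have tau01 : 0 < tau <= 1 by rewrite divr_gt0 // ler_pdivrMr // mul1r lerDl ltW.
exists tau => //; case/andP: tau01 => tau0 tau1.
have tM : tau * M <= eps.
  by rewrite /tau mulrAC ler_pdivrMr // ler_pM2l // lerDr ltW.
have t01 : 0 <= tau <= 1 by rewrite ltW.
have n2 := ler_norm (phi 2); have n0 := ler_norm (phi 0).
have a2 := normr_ge0 (phi 2); have a0 := normr_ge0 (phi 0).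
split; apply: le_trans tM.
- have := @phi_conv 2 1 tau (ler0n _ 2) ler01 t01.
  rewrite phi1 mulr0 addr0 (_ : tau * 2 + _ = 1 + tau); last by ring.
  by move=> /le_trans; apply; rewrite ler_pM2l // /M; lra.
- have := @phi_conv 0 1 tau (lexx 0) ler01 t01.
  rewrite phi1 !mulr0 addr0 add0r mulr1.
  by move=> /le_trans; apply; rewrite ler_pM2l // /M; lra.
Qed.

(* One Lagrange multiplier per constraint: first eta for the equality
   constraint, then lambda for the divergence constraint. *)
Lemma weight_multipliers eps j : 0 < eps ->
  (forall p, weight_dom p -> excess p = 0 -> divergence p <= eps -> payoff p <= j) ->
  exists lam eta, 0 <= lam /\ forall p, weight_dom p ->
    payoff p - eta * excess p - lam * (divergence p - eps) <= j.
Proof.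
move=> eps0 Hj.
have t01 (a b : R) : 0 < a -> b < 0 -> 0 <= - b / (a - b) <= 1.
  move=> a0 b0; have ab : 0 < a - b by lra.
  by rewrite divr_ge0 ?ler_pdivrMr //=; lra.
have tmix (a b c e : R) : 0 < a -> b < 0 ->
    - b / (a - b) * c + (1 - - b / (a - b)) * e = (a * e - b * c) / (a - b).
  by move=> a0 b0; have ab : 0 < a - b by [lra]; field; rewrite gt_eqF.
have [tau /andP[tau0 tau1] [phip phim]] := phat_scale_slater eps0.
have [||||eta etaP] := @multiplier_exists R
    [set z | exists p, [/\ weight_dom p, divergence p <= eps & z = (excess p, payoff p)]] j.
- move=> a y b z [p [Cp Dp [aE yE]]] [q [Cq Dq [bE zE]]] a0 b0.
  have t := t01 _ _ a0 b0; have ab : 0 < a - b by lra.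
  have : payoff (mix (- b / (a - b)) p q) <= j.
    apply: Hj; first exact: weight_dom_mix.
    - by rewrite excess_mix -aE -bE tmix // (mulrC a b) subrr mul0r.
    - apply: le_trans (divergence_mix t Cp Cq) _.
      by case/andP: t => t0 t1; move: t0 t1; set u := - b / _ => t0 t1; nra.
  by rewrite payoff_mix -yE -zE tmix // ler_pdivrMr.
- have [C1 D1 E1] := @phat_scale (1 + tau) (addr_ge0 ler01 (ltW tau0)).
  exists tau, (payoff (fun k => phat k * (1 + tau))); split=> //.
  exists (fun k => phat k * (1 + tau)); rewrite D1 E1; split=> //; congr pair; lra.
- have t1 : 0 <= 1 - tau by lra.
  have [C1 D1 E1] := phat_scale t1.
  exists (- tau), (payoff (fun k => phat k * (1 - tau))); split; last by lra.
  exists (fun k => phat k * (1 - tau)); rewrite D1 E1; split=> //; congr pair; lra.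
- by move=> y [p [Cp Dp [E0 ->]]]; apply: Hj.
have [C1 D1 E1] := phat_scale ler01.
set phat' := fun k => phat k * 1 in C1 D1 E1; rewrite phi1 in D1; rewrite subrr in E1.
(* Taking the violation as an upper bound makes the set closed upward in its first coordinate. Hence
   [phat] alone supplies a point at 1 and one at [- eps], and [lam] cannot be negative. *)
have [||||lam lamP] := @multiplier_exists R
    [set z | exists p, [/\ weight_dom p, divergence p - eps <= z.1 &
       z.2 = payoff p - eta * excess p]] j.
- move=> a y b z [p [Cp /= Dp yE]] [q [Cq /= Dq zE]] a0 b0.
  have t := t01 _ _ a0 b0; have ab : 0 < a - b by lra.
  have Dm : divergence (mix (- b / (a - b)) p q) <= eps.
    apply: le_trans (divergence_mix t Cp Cq) _.
    have : - b / (a - b) * a + (1 - - b / (a - b)) * b = 0.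
      by rewrite tmix // (mulrC a b) subrr mul0r.
    by case/andP: t => t0 t1; move: t0 t1; set u := - b / _ => t0 t1; nra.
  have := etaP _ _ (ex_intro _ _ (And3 (weight_dom_mix t Cp Cq) Dm erefl)).
  rewrite payoff_mix excess_mix => le_j.
  have : - b / (a - b) * y + (1 - - b / (a - b)) * z <= j.
    by rewrite yE zE; apply: le_trans le_j; rewrite le_eqVlt; apply/orP; left; apply/eqP; ring.
  by rewrite tmix // ler_pdivrMr.
- exists 1, (payoff phat' - eta * excess phat'); split=> //.
  by exists phat'; split=> //=; rewrite D1; lra.
- exists (- eps), (payoff phat' - eta * excess phat'); split; last by lra.
  by exists phat'; split=> //=; rewrite D1; lra.
- move=> y [p [Cp /= Dp ->]]; apply: etaP; exists p; split=> //; lra.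
exists lam, eta; split; last first.
  by move=> p Cp; apply: lamP; exists p.
rewrite leNgt; apply/negP => lam0.
(* The violation [a] is so large that a negative [lam] would push the value at [phat] above [j]. *)
pose y0 := payoff phat'; pose a := (`|j - y0| + 1) / - lam.
have a0 : 0 < a by rewrite divr_gt0 ?oppr_gt0 // ltr_wpDl.
have : y0 - eta * excess phat' - lam * a <= j.
  by apply: lamP; exists phat'; split=> //=; rewrite D1; lra.
rewrite E1 mulr0 subr0 (_ : lam * a = - (`|j - y0| + 1)).
  by have := ler_norm (j - y0); lra.
by rewrite /a; field; rewrite lt_eqF.
Qed.

(* Compactness of the simplex gives a limit weight; mixing it with phat makes its
   coordinates positive, where the perspective functions have subgradients. *)
Lemma weight_bound_stable j j' : j < j' ->
  (forall p, weight_dom p -> excess p = 0 -> divergence p <= 0 -> payoff p <= j) ->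
  exists2 e, 0 < e & forall p, weight_dom p -> excess p = 0 -> divergence p <= e ->
    payoff p <= j'.
Proof.
move=> jj' Hj; apply: contrapT => nex.
have /choice [p pP] (n : nat) : exists p,
    [/\ weight_dom p, excess p = 0, divergence p <= n.+1%:R^-1 & j' < payoff p].
  apply: contrapT => np; apply: nex; exists n.+1%:R^-1; first by rewrite invr_gt0.
  by move=> p Cp Ep Dp; rewrite leNgt; apply/negP => Fp; apply: np; exists p.
have p01 n k : 0 <= p n k <= 1.
  have [Cp /eqP Ep _ _] := pP n; rewrite (Cp k).1 /=.
  move: Ep; rewrite subr_eq0 => /eqP <-.
  by rewrite (bigD1 k) //= lerDl sumr_ge0 // => i _; apply: (Cp i).1.
have [P PP] := rV_bounded_cluster p01.
have CP : weight_dom P.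
  move=> k; have Pk0 : 0 <= P k.
    apply: (@ler_addgt0_scale _ _ _ 1) => // e e0.
    have [n [_ /(_ k)]] := PP e e0; rewrite ler_norml => /andP[_ h].
    by have /andP[] := p01 n k; lra.
  (* Where the slope is infinite, every [p n k] is 0, and so is the limit. *)
  have [[h [hE _ _ _]]|[q0 p_eq0]] := dichotomy k; first by split; rewrite ?hE ?ltry.
  suff -> : P k = 0 by split; rewrite // /phi_persp q0 !eqxx ltry.
  apply: le_anti; rewrite Pk0 andbT.
  apply: (@ler_addgt0_scale _ _ _ 1) => // e e0.
  have [n [_ /(_ k)]] := PP e e0; have [Cn _ _ _] := pP n.
  by rewrite (p_eq0 _ (Cn k).1 (Cn k).2) ler_norml => /andP[h1 h2]; lra.
have EP : excess P = 0.
  apply/eqP; rewrite -normr_eq0; apply/eqP/le_anti; rewrite normr_ge0 andbT.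
  apply: (@ler_addgt0_scale _ _ _ K%:R) => // e e0.
  have [n [_ nP]] := PP e e0; have [_ En _ _] := pP n.
  rewrite add0r -[excess P]subr0 -{}En /excess opprB addrA subrK -sumrB.
  apply: le_trans (ler_norm_sum _ _ _) _.
  have -> : K%:R * e = \sum_(k < K) e by rewrite sumr_const card_ord mulr_natl.
  by apply: ler_sum => k _; rewrite distrC.
have FP : j' <= payoff P.
  apply: (@ler_addgt0_scale _ _ _ (\sum_k `|f k|)); first by rewrite sumr_ge0.
  move=> e e0; have [n [_ nP]] := PP e e0; have [_ _ _ /ltW Fn] := pP n.
  apply: le_trans Fn _; rewrite -lerBlDl /payoff -sumrB mulr_suml.
  apply: ler_sum => k _; rewrite -mulrBl; apply: le_trans (ler_norm _) _.
  by rewrite normrM mulrC ler_wpM2l.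
have [C1 D1 E1] := phat_scale ler01.
set phat' := fun k => phat k * 1 in C1 D1 E1; rewrite phi1 in D1; rewrite subrr in E1.
pose M := `|payoff phat' - payoff P| + 1.
have M0 : 0 < M by rewrite ltr_wpDl.
have jj0 : 0 < j' - j by rewrite subr_gt0.
have jM : 0 < j' - j + M by rewrite addr_gt0.
(* Small enough that mixing costs less than [j' - j] of payoff: [x] would still pay more than [j],
   contradicting [Hj]. *)
pose tau := (j' - j) / (j' - j + M).
have tau0 : 0 < tau by rewrite divr_gt0.
have tau1 : tau < 1 by rewrite ltr_pdivrMr // mul1r ltrDl.
have t01 : 0 <= tau <= 1 by rewrite !ltW.
pose x := mix tau phat' P.
have Cx : weight_dom x by exact: weight_dom_mix.
have /choice [s sP] k : exists s, forall y, persp_dom k y ->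
    persp k (x k) + s * (y - x k) <= persp k y.
  apply: persp_subgradient => // phat_gt0.
  rewrite /x /mix /phat' mulr1; apply: ltr_wpDr; last exact: mulr_gt0.
  by apply: mulr_ge0; [rewrite subr_ge0 ltW|exact: (CP k).1].
(* The subgradients at [x] compare it with the mixture of [phat] and [p n], whose divergence is at
   most [(1 - tau) / (n + 1)] because [phat] has divergence 0. *)
have Dx : divergence x <= 0.
  apply: (@ler_addgt0_scale _ _ _ (1 + \sum_k `|s k|)).
    by rewrite addr_ge0 // sumr_ge0.
  move=> e e0; have [n [ne nP]] := PP e e0; have [Cn _ Dn _] := pP n.
  have := divergence_mix t01 C1 Cn; rewrite D1 mulr0 add0r => Dm.
  have Cm := weight_dom_mix t01 C1 Cn.
  have le1 : (1 - tau) * divergence (p n) <= e.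
    apply: le_trans (_ : (1 - tau) * e <= e).
      by rewrite ler_wpM2l ?subr_ge0 ?(ltW tau1) // (le_trans Dn).
    by rewrite ler_piMl ?(ltW e0) // gerBl ltW.
  have le2 : divergence x - (\sum_k `|s k|) * e <= divergence (mix tau phat' (p n)).
    rewrite /divergence mulr_suml -sumrB; apply: ler_sum => k _.
    apply: le_trans (sP k _ (Cm k)); rewrite lerD2l lerNl -mulrN.
    apply: le_trans (ler_norm _) _; rewrite normrM ler_wpM2l // normrN.
    rewrite /x /mix (_ : _ - _ = (1 - tau) * (p n k - P k)); last by ring.
    rewrite normrM ger0_norm ?subr_ge0 ?(ltW tau1) //.
    apply: le_trans (nP k); by rewrite ler_piMl // gerBl ltW.
  by rewrite mulrDl mul1r add0r -lerBlDr (le_trans le2) // (le_trans Dm).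
have Ex : excess x = 0 by rewrite excess_mix E1 EP !mulr0 addr0.
have := Hj x Cx Ex Dx; rewrite payoff_mix => le_j.
have tM : tau * M < j' - j.
  by rewrite /tau mulrAC ltr_pdivrMr // ltr_pM2l // ltrDr.
have := ler_norm (- (payoff phat' - payoff P)); rewrite normrN => hn.
have : tau * (payoff P - payoff phat') <= tau * M by rewrite ler_pM2l // /M; lra.
by lra.
Qed.

(** Multipliers for a small budget [e > 0] also serve budget 0, since the term [lam * e] that is
    dropped is nonnegative. *)
Lemma weight_multipliers_approx j j' : j < j' ->
  (forall p, weight_dom p -> excess p = 0 -> divergence p <= 0 -> payoff p <= j) ->
  exists lam eta, 0 <= lam /\ forall p, weight_dom p ->
    payoff p - eta * excess p - lam * divergence p <= j'.
Proof.
move=> jj' Hj; have [e e0 He] := weight_bound_stable jj' Hj.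
have [lam [eta [lam0 H]]] := weight_multipliers e0 He.
exists lam, eta; split=> // p Cp; have := H p Cp.
by have := mulr_ge0 lam0 (ltW e0); lra.
Qed.

(** No summand of the divergence is -oo, so a finite total makes each one finite; the bound by 1 on
    a weight follows from the signs and the total. *)
Lemma weight_setP eps p : weight_set phi eps phat p <->
  [/\ weight_dom p, excess p = 0 & divergence p <= eps].
Proof.
have divE : weight_dom p -> phi_div phi p phat = (divergence p)%:E.
  by move=> Cp; rewrite /phi_div /divergence -sumEFin; apply: eq_bigr => k _; exact: perspE.
split=> [[p01 p1 Dp]|[Cp Ep Dp]].
  have Cp : weight_dom p.
    move=> k; have /andP[pk0 _] := p01 k; split=> //.
    rewrite ltNge leye_eq; apply/negP => /eqP pk.
    suff : phi_div phi p phat = +oo%E by move=> E; rewrite E in Dp.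
    apply/eqP; rewrite esum_eqy; last first.
      by move=> i _; apply: phi_persp_neqNy; case/andP: (p01 i).
    by apply/existsP; exists k; rewrite pk eqxx.
  by split=> //; [rewrite /excess p1 subrr|rewrite -lee_fin -divE].
have p1 : \sum_k p k = 1 by move/eqP: Ep; rewrite subr_eq0 => /eqP.
split=> //; last by rewrite divE.
move=> k; rewrite (Cp k).1 -p1 (bigD1 k) //= lerDl sumr_ge0 // => i _.
exact: (Cp i).1.
Qed.

End weight_duality.

(** The coordinates vary independently. Freezing all but one shows that each supremum is finite, and
    choices within [e] of each supremum then lose at most [K%:R * e] in total. *)
Lemma sum_ereal_sup_le (R : realType) K (D : 'I_K -> set R) (a : 'I_K -> R -> R) j :
  (forall k, D k !=set0) ->
  (forall s, (forall k, D k (s k)) -> \sum_k a k (s k) <= j) ->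
  (\sum_k ereal_sup [set (a k p)%:E | p in D k] <= j%:E)%E.
Proof.
move=> /choice [s0 Ds0] H; pose T k := ereal_sup [set (a k p)%:E | p in D k].
have Tfin k : T k \is a fin_num.
  rewrite fin_numElt; apply/andP; split.
    apply: (@lt_le_trans _ _ (a k (s0 k))%:E); first exact: ltNyr.
    by apply: ereal_sup_ubound; exists (s0 k).
  apply: (@le_lt_trans _ _ (j - \sum_(i | i != k) a i (s0 i))%:E); last exact: ltry.
  apply: ge_ereal_sup => _ [p Dp <-]; rewrite lee_fin lerBrDr.
  have := H (fun i => if i == k then p else s0 i).
  rewrite (bigD1 k) //= eqxx => le_j; apply: le_trans (le_j _); last first.
    by move=> i; case: eqP => [->|].
  rewrite lerD2l le_eqVlt; apply/orP; left; apply/eqP.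
  by apply: eq_bigr => i /negbTE ->.
under eq_bigr => k _ do rewrite -[ereal_sup _]/(T k) -(fineK (Tfin k)).
rewrite sumEFin lee_fin; apply: (@ler_addgt0_scale _ _ _ K%:R) => // e e0.
have /choice [s sP] k : exists p, D k p /\ fine (T k) - e <= a k p.
  have [_ [p Dp <-] lt_p] := ub_ereal_sup_adherent e0 (Tfin k).
  by exists p; split=> //; move: lt_p; rewrite -lee_fin EFinB fineK // => /ltW.
have -> : K%:R * e = \sum_(k < K) e by rewrite sumr_const card_ord mulr_natl.
rewrite -lerBlDr -sumrB; apply: le_trans (H s (fun k => (sP k).1)).
by apply: ler_sum => k _; exact: (sP k).2.
Qed.

(** * The dual objective as a supremum of Lagrangians *)

Section dual_objective.
Variables (R : realType) (K : nat) (phi : R -> R) (phat f : 'I_K -> R) (eps : R).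
Hypothesis cphi : convex_function (`[0, +oo[%classic : set R) phi.
Hypothesis phi1 : phi 1 = 0.
Hypothesis phat0 : forall k, 0 <= phat k.

(** One formula for both branches of [dual_obj]: the scaled conjugate for [lam > 0], the support
    function of the domain for [lam = 0]. *)
Definition lagrangian_term k (lam eta : R) : \bar R :=
  ereal_sup [set (p * (f k - eta) - lam * persp phi phat k p)%:E
            | p in [set p | persp_dom phi phat k p]].

Lemma persp_dom_phat k : persp_dom phi phat k (phat k).
Proof. by have := (persp_scale cphi phi1 phat0 k ler01).1; rewrite mulr1. Qed.

Lemma lagrangian_term_neqNy k lam eta : lagrangian_term k lam eta != -oo%E.
Proof.
rewrite -ltNye.
apply: (@lt_le_trans _ _ (phat k * (f k - eta) - lam * persp phi phat k (phat k))%:E).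
  exact: ltNyr.
by apply: ereal_sup_ubound; exists (phat k) => //; exact: persp_dom_phat.
Qed.

Lemma wphi_conj_recE k eta :
  wphi_conj_rec phi (phat k) (f k - eta) = lagrangian_term k 0 eta.
Proof.
by congr ereal_sup; apply/seteqP; split=> _ [t Dt <-]; exists t; rewrite // mul0r subr0.
Qed.

(** For positive nominal weight this is the change of variable [p = phat k * t]. For weight 0 the
    points outside the domain contribute -oo to the supremum. *)
Lemma wphi_conjE k lam eta : 0 < lam ->
  (lam%:E * wphi_conj phi (phat k) ((f k - eta) / lam))%E =
  lagrangian_term k lam eta.
Proof.
move=> lam0; rewrite /wphi_conj; have [q0|qn0] := eqVneq (phat k) 0.
  rewrite -ereal_sup_pZl //; apply/eqP; rewrite eq_le; apply/andP; split.
    apply: ge_ereal_sup => _ [_ [t t0 <-] <-].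
    have [Dt|nDt] := pselect (persp_dom phi phat k t); last first.
      have -> : phi_persp phi 0 t = +oo%E.
        apply/eqP; rewrite -leye_eq leNgt; apply/negP => h.
        by apply: nDt; split=> //; rewrite q0.
      by rewrite -[(- +oo)%E]/(-oo)%E addeNy gt0_muleNy ?lte_fin // leNye.
    apply: ereal_sup_ubound; exists t => //.
    rewrite -q0 (perspE cphi phi1 phat0 Dt) -EFinB -EFinM; congr EFin.
    by field; rewrite gt_eqF.
  apply: ge_ereal_sup => _ [t Dt <-]; apply: ereal_sup_ubound.
  exists ((t * ((f k - eta) / lam))%:E - phi_persp phi 0 t)%E.
    by exists t => //; exact: Dt.1.
  rewrite -q0 (perspE cphi phi1 phat0 Dt) -EFinB -EFinM; congr EFin.
  by field; rewrite gt_eqF.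
have qgt0 : 0 < phat k by rewrite lt0r qn0 phat0.
rewrite muleA -EFinM -ereal_sup_pZl ?mulr_gt0 //.
congr ereal_sup; apply/seteqP; split=> [_ [_ [t t0 <-] <-]|_ [p Dp <-]].
  have [Dt tE] := persp_scale cphi phi1 phat0 k t0.
  exists (phat k * t) => //; rewrite -EFinM tE; congr EFin.
  by field; rewrite gt_eqF.
have pE : phat k * (p / phat k) = p by rewrite mulrCA divff ?mulr1.
have p0 : 0 <= p / phat k by rewrite divr_ge0 // Dp.1.
exists (p / phat k * ((f k - eta) / lam) - phi (p / phat k))%:E.
  by exists (p / phat k).
have [_] := persp_scale cphi phi1 phat0 k p0; rewrite pE => ->.
by rewrite -EFinM; congr EFin; field; rewrite !gt_eqF.
Qed.

Lemma dual_objE lam eta : 0 <= lam ->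
  dual_obj phi eps phat f (lam, eta) =
  ((eta + eps * lam)%:E + \sum_k lagrangian_term k lam eta)%E.
Proof.
move=> lam0; rewrite /dual_obj; congr (_ + _)%E; have [->|lamn0] := eqVneq lam 0.
  by apply: eq_bigr => k _; exact: wphi_conj_recE.
have lamgt0 : 0 < lam by rewrite lt0r lamn0.
rewrite fin_num_sume_distrr //; first by apply: eq_bigr => k _; exact: wphi_conjE.
have nNy k : wphi_conj phi (phat k) ((f k - eta) / lam) != -oo%E.
  apply/eqP => E; have := lagrangian_term_neqNy k lam eta.
  by rewrite -wphi_conjE // E gt0_muleNy ?lte_fin // eqxx.
by move=> i k _ _; apply: ltninfty_adde_def; rewrite inE ltNye nNy.
Qed.

Lemma dual_obj_ge_payoff z p : dual_dom z ->
  weight_dom phi phat p -> excess p = 0 -> divergence phi phat p <= eps ->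
  ((payoff f p)%:E <= dual_obj phi eps phat f z)%E.
Proof.
case: z => lam eta lam0 Cp Ep Dp; have {}lam0 : 0 <= lam := lam0.
rewrite dual_objE //.
have : (\sum_k (p k * (f k - eta) - lam * persp phi phat k (p k))%:E <=
        \sum_k lagrangian_term k lam eta)%E.
  apply: lee_sum => k _; apply: ereal_sup_ubound; exists (p k) => //; exact: Cp.
move=> /(leeD2l (eta + eps * lam)%:E); apply: le_trans.
rewrite sumEFin -EFinD lee_fin.
have -> : \sum_k (p k * (f k - eta) - lam * persp phi phat k (p k)) =
    payoff f p - eta * (excess p + 1) - lam * divergence phi phat p.
  rewrite /payoff /excess /divergence subrK !mulr_sumr -!sumrB.
  by apply: eq_bigr => k _; ring.
rewrite Ep add0r; have : lam * divergence phi phat p <= lam * eps by exact: ler_wpM2l.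
by lra.
Qed.

(** The Lagrangian is separable in the weights, so its bound over all of [weight_dom] bounds the sum
    of the coordinatewise suprema. *)
Lemma dual_obj_le lam eta j : 0 <= lam ->
  (forall p, weight_dom phi phat p ->
    payoff f p - eta * excess p - lam * (divergence phi phat p - eps) <= j) ->
  (dual_obj phi eps phat f (lam, eta) <= j%:E)%E.
Proof.
move=> lam0 H; rewrite dual_objE // -leeBrDl // -EFinB.
apply: sum_ereal_sup_le => [k|p Cp]; first by exists (phat k); exact: persp_dom_phat.
have -> : \sum_k (p k * (f k - eta) - lam * persp phi phat k (p k)) =
    payoff f p - eta * (excess p + 1) - lam * divergence phi phat p.
  rewrite /payoff /excess /divergence subrK !mulr_sumr -!sumrB.
  by apply: eq_bigr => k _; ring.
by have := H p Cp; lra.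
Qed.

(** For fixed [p] the bracket is affine in [(lam, eta)], and a supremum of affine functions is
    convex. No term is -oo, which legitimates distributing the products over the sums. *)
Lemma dual_obj_convex : convex_ereal_on (@dual_dom R) (dual_obj phi eps phat f).
Proof.
move=> [lam eta] [lam' eta'] t lam0 lam0' /andP[t0 t1].
have {}lam0 : 0 <= lam := lam0; have {}lam0' : 0 <= lam' := lam0'.
have t1' : 0 <= 1 - t by rewrite subr_ge0.
rewrite -[(_, _)]/(t * lam + (1 - t) * lam', t * eta + (1 - t) * eta').
rewrite !dual_objE ?addr_ge0 ?mulr_ge0 //.
set a := (eta + eps * lam); set b := (eta' + eps * lam').
have termNy := lagrangian_term_neqNy.
have sumNy l e : (\sum_k lagrangian_term k l e)%E != -oo%E.
  by rewrite esum_eqNy; apply/existsPn => k; rewrite termNy.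
rewrite !muleDr ?fin_num_adde_defr // addeACA -!EFinM -EFinD.
rewrite (_ : _ + eps * _ = t * a + (1 - t) * b); last by rewrite /a /b; ring.
rewrite leeD2l // !fin_num_sume_distrr //; last 2 first.
- by move=> i k _ _; apply: ltninfty_adde_def; rewrite inE ltNye termNy.
- by move=> i k _ _; apply: ltninfty_adde_def; rewrite inE ltNye termNy.
rewrite -big_split /=; apply: lee_sum => k _; apply: ge_ereal_sup => _ [p Dp <-].
rewrite (_ : _ - _ = t * (p * (f k - eta) - lam * persp phi phat k p) +
  (1 - t) * (p * (f k - eta') - lam' * persp phi phat k p)); last by ring.
rewrite EFinD !EFinM leeD // lee_wpmul2l ?lee_fin //;
  by apply: ereal_sup_ubound; exists p.
Qed.

End dual_objective.

(** * Reduction of the worst mixture to its weights *)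

Section ambiguity_set_value.
Variables (R : realType) (d K : nat) (mhat : 'I_K -> 'cV[R]_d).
Variables (Shat : 'I_K -> 'M[R]_d) (rho phat f : 'I_K -> R) (phi : R -> R).
Variables (eps : R) (x : 'cV[R]_d).
Let ball k := gelbrich_ball (mhat k) (Shat k) (rho k).
Hypothesis fE : forall k, worst_prob (ball k) x = (f k)%:E.
Let J := worst_prob (ambiguity_set mhat Shat rho phi eps phat) x.

(** Attainment in the balls is not presupposed: laws within [e] of each supremum are mixed, and the
    total loss is [e] since the weights sum to 1. *)
Lemma payoff_le_worst_prob p : weight_set phi eps phat p -> ((payoff f p)%:E <= J)%E.
Proof.
move=> Dp; case: (Dp) => p01 p1 _; have p0 k : 0 <= p k by case/andP: (p01 k).
apply/lee_addgt0Pr => e e0.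
have /choice [Q QP] k : exists Q, ball k Q /\ ((f k - e)%:E <= Q (unfavorable x))%E.
  have : ((f k - e)%:E < worst_prob (ball k) x)%E by rewrite fE lte_fin; lra.
  by move=> /ereal_sup_gt [_ [Q QB <-] /ltW]; exists Q.
have [P [PE _]] := mixture_exists Q p0 p1.
have PA : ambiguity_set mhat Shat rho phi eps phat P.
  by exists p, Q; split=> // k; exact: (QP k).1.
apply: (@le_trans _ _ (P (unfavorable x) + e%:E)%E); last first.
  by rewrite leeD2r //; apply: ereal_sup_ubound; exists P.
rewrite -leeBlDr // -EFinB PE.
apply: (@le_trans _ _ (\sum_k (p k)%:E * (f k - e)%:E)%E); last first.
  by apply: lee_sum => k _; rewrite lee_wpmul2l ?lee_fin //; exact: (QP k).2.
under eq_bigr do rewrite -EFinM mulrBr.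
by rewrite sumEFin lee_fin sumrB -mulr_suml p1 mul1r.
Qed.

Lemma worst_prob_le_payoff (j : \bar R) :
  (forall p, weight_set phi eps phat p -> ((payoff f p)%:E <= j)%E) -> (J <= j)%E.
Proof.
move=> H; apply: ge_ereal_sup => _ [P [p [Q [Dp QB PE]]] <-].
have mA := measurable_unfavorable x; rewrite PE //; apply: le_trans (H _ Dp).
case: Dp => p01 _ _; rewrite /payoff -sumEFin; apply: lee_sum => k _.
rewrite EFinM lee_wpmul2l ?lee_fin //; first by case/andP: (p01 k).
by rewrite -(fE k) /worst_prob; apply: ereal_sup_ubound; exists (Q k); [exact: QB|].
Qed.

End ambiguity_set_value.

Theorem worst_prob_dual (R : realType) d K (mhat : 'I_K -> 'cV[R]_d)
    (Shat : 'I_K -> 'M[R]_d) (rho phat f : 'I_K -> R) (phi : R -> R) (eps : R)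
    (x : 'cV[R]_d) :
  convex_function (`[0, +oo[%classic : set R) phi -> phi 1 = 0 ->
  (forall k, 0 <= phat k) -> \sum_k phat k = 1 -> 0 <= eps ->
  (forall k, worst_prob (gelbrich_ball (mhat k) (Shat k) (rho k)) x = (f k)%:E) ->
  let J := worst_prob (ambiguity_set mhat Shat rho phi eps phat) x in
  let g := dual_obj phi eps phat f in
  J = ereal_inf [set g z | z in @dual_dom R] /\
  (0 < eps -> exists2 z, dual_dom z & g z = J).
Proof.
move=> cphi phi1 phat0 phat1 eps0 fE J g.
have setP := weight_setP cphi phi1 phat0.
have weak z : dual_dom z -> (J <= g z)%E.
  move=> Dz; apply: (worst_prob_le_payoff fE) => p /setP [Cp Ep Dp].
  exact: dual_obj_ge_payoff.
have payJ p : weight_dom phi phat p -> excess p = 0 -> divergence phi phat p <= eps ->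
    ((payoff f p)%:E <= J)%E.
  by move=> Cp Ep Dp; apply: (payoff_le_worst_prob fE); exact/setP.
(* The nominal weights are feasible because [phi 1 = 0], so the value lies above a real payoff and
   below 1. *)
have Jfin : J \is a fin_num.
  have [C1 D1 E1] := phat_scale cphi phi1 phat0 phat1 ler01.
  rewrite fin_numElt; apply/andP; split.
    apply: lt_le_trans (payJ _ C1 _ _); first exact: ltNyr.
      by rewrite E1 subrr.
    by rewrite D1 phi1.
  by apply: le_lt_trans (worst_prob_le1 _ _) _; exact: ltry.
have payj p : weight_dom phi phat p -> excess p = 0 -> divergence phi phat p <= eps ->
    payoff f p <= fine J.
  by move=> Cp Ep Dp; rewrite -lee_fin fineK //; exact: payJ.
have attained : 0 < eps -> exists2 z, dual_dom z & g z = J.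
  move=> eps_gt0.
  have [lam [eta [lam0 H]]] := weight_multipliers cphi phi1 phat0 phat1 eps_gt0 payj.
  exists (lam, eta) => //; apply/eqP; rewrite eq_le weak // andbT.
  by rewrite -(fineK Jfin); exact: dual_obj_le.
split=> //; apply/eqP; rewrite eq_le; apply/andP; split.
  by apply: le_ereal_inf_tmp => _ [z Dz <-]; exact: weak.
have [eps_gt0|] := ltP 0 eps.
  by have [z Dz <-] := attained eps_gt0; apply: ereal_inf_lbound; exists z.
move=> epsle0; have eps_eq0 : eps = 0 by apply/le_anti; rewrite epsle0 eps0.
(* For [eps = 0] only multipliers within [e] of the value are available, which suffices for the
   infimum. *)
rewrite eps_eq0 in payj; apply/lee_addgt0Pr => e e0.
have jj : fine J < fine J + e by rewrite ltrDl.
have [lam [eta [lam0 H]]] := weight_multipliers_approx cphi phi1 phat0 phat1 jj payj.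
apply: (@le_trans _ _ (g (lam, eta))).
  by apply: ereal_inf_lbound; exists (lam, eta).
rewrite -(fineK Jfin) -EFinD; apply: dual_obj_le => // p Cp.
by rewrite eps_eq0 subr0; exact: H.
Qed.

Theorem theoremC2 (R : realType) (d K : nat) (hd : (1 <= d)%N) (hK : (1 <= K)%N)
  (X : set 'cV[R]_d) (x0 : 'cV[R]_d) (delta eps : R)
  (hdelta : 0 <= delta) (heps : 0 <= eps)
  (c : 'cV[R]_d -> 'cV[R]_d -> R)
  (c_ge0 : forall x y, 0 <= c x y)
  (c_cont : continuous (fun z : 'cV[R]_d * 'cV[R]_d => c z.1 z.2))
  (phi : R -> R) (phi_convex : convex_function (`[0, +oo[%classic : set R) phi)
  (phi1 : phi 1 = 0)
  (mhat : 'I_K -> 'cV[R]_d) (Shat : 'I_K -> 'M[R]_d) (rho : 'I_K -> R)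
  (hShat : forall k, posdefmx (Shat k)) (hrho : forall k, 0 <= rho k)
  (phat : 'I_K -> R) (phat_ge0 : forall k, 0 <= phat k)
  (phat_sum : \sum_(k < K) phat k = 1) :
  let f := fun (k : 'I_K) (x : 'cV[R]_d) =>
    worst_prob (gelbrich_ball (mhat k) (Shat k) (rho k)) x in
  let calX := robust_set X c x0 delta mhat rho in
  [/\ feasible_set X c x0 delta mhat Shat rho = calX,
      forall x, calX x ->
        let J := worst_prob (ambiguity_set mhat Shat rho phi eps phat) x in
        let g := dual_obj phi eps phat (fun k => fine (f k x)) in
        [/\ convex_ereal_on (@dual_dom R) g,
            J = ereal_inf [set g z | z in @dual_dom R] &
            0 < eps -> exists2 z, dual_dom z & g z = J]
    & forall (k : 'I_K) (x : 'cV[R]_d),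
        let A := - dotv (mhat k) x in
        let B := Num.sqrt (quadform (Shat k) x) in
        let C := rho k * norm2 x in
        let v := ((- A * C + B * Num.sqrt (A ^+ 2 + B ^+ 2 - C ^+ 2)) /
                  (A ^+ 2 + B ^+ 2)) ^+ 2 in
        (0 <= A + C -> f k x = 1%E) /\
        (A + C < 0 -> f k x = v%:E /\ 0 < v < 1)].
Proof.
move=> f calX.
have degenerate k x := @worst_prob_degenerate _ _ hd (mhat k) _ _ (hShat k) (hrho k) x.
have regular k x := @worst_prob_regular _ _ hd (mhat k) _ _ (hShat k) (hrho k) x.
split; last by move=> k x; split; [exact: degenerate|exact: regular].
- apply/seteqP; split=> x [Xx cx fx]; split=> // k.
    rewrite ltNge; apply/negP => AC.
    by have := fx k; rewrite degenerate // ltxx.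
  by have [-> /andP[_ v1]] := regular k x (fx k); rewrite lte_fin.
- move=> x [_ _ fx] J g.
  have fE k : f k x = (fine (f k x))%:E.
    by have [E _] := regular k x (fx k); rewrite /f E.
  have [JE att] := worst_prob_dual phi_convex phi1 phat_ge0 phat_sum heps fE.
  by split=> //; exact: dual_obj_convex.
Qed.
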